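(* Let $k$ be an algebraically closed field and $A$ a finite-dimensional unital associative $k$-algebra. Then the lattice $\mathcal{L}_t(A)$ of pretorsion classes of $\mathrm{mod}\,A$ is distributive if and only if each indecomposable module in $\mathrm{mod}\,A$ has a unique maximal submodule.
   Context: $\mathrm{mod}\,A$ is the category of finitely generated right $A$-modules. A pretorsion class of $\mathrm{mod}\,A$ is a full subcategory, closed under isomorphisms, containing $0$ and closed under quotients and finite direct sums. $\mathcal{L}_t(A)$ is the set of pretorsion classes of $\mathrm{mod}\,A$ ordered by inclusion; it is a complete lattice with meet $\mathcal{T}_1\cap\mathcal{T}_2$ and join the smallest pretorsion class containing $\mathcal{T}_1\cup\mathcal{T}_2$. *)

(* Defs.v *)
From HB Require Import structures.
From mathcomp Require Import all_boot all_order all_algebra all_field.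
From mathcomp Require Import boolp classical_sets.

Set Implicit Arguments.
Unset Strict Implicit.
Unset Printing Implicit Defensive.

Import GRing.Theory.
Local Open Scope ring_scope.

(* Modules range over all of [lmodType A^c], so [modf A] and [pretorsion_class A]
   live in a universe above the one in which MathComp's eqType, choiceType and
   latticeType structures can be built. The lattice of pretorsion classes is
   therefore given by a Prop-valued order, with [pretorsion_meetP] and
   [pretorsion_joinP] characterizing its meet and join. *)

(* A right A-module is a module over the converse ring A^c:
   [a *: x] is to be read x a, and (a *: (b *: x)) is x (b a). *)
Definition finitely_generated (A : nzRingType) (M : lmodType A^c) : Prop :=
  exists (n : nat) (g : 'I_n -> M),
    forall x : M, exists a : 'I_n -> A^c, x = \sum_(i < n) a i *: g i.

Record modf (A : nzRingType) : Type := Modf {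
  modf_sort :> lmodType A^c;
  modf_fg : finitely_generated modf_sort
}.

Lemma finitely_generated_prod (A : nzRingType) (M N : modf A) :
  @finitely_generated A (M * N)%type.
Proof.
have [m [g gP]] := modf_fg M; have [n [h hP]] := modf_fg N.
exists (m + n)%N,
  (fun i => match split i with inl j => (g j, 0) | inr j => (0, h j) end).
move=> [x y]; have [a ->] := gP x; have [b ->] := hP y.
exists (fun i => match split i with inl j => a j | inr j => b j end).
have splitl i : split (lshift n i) = inl i := unsplitK (inl i : 'I_m + 'I_n).
have splitr i : split (rshift m i) = inr i := unsplitK (inr i : 'I_m + 'I_n).
rewrite big_split_ord /=.
under [X in _ = X + _]eq_bigr do rewrite splitl.
under [X in _ = _ + X]eq_bigr do rewrite splitr.
apply/pair_equal_spec; rewrite !raddf_sum /=; split.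
- by rewrite [X in _ = _ + X]big1 ?addr0 // => i _; rewrite scaler0.
- by rewrite [X in _ = X + _]big1 ?add0r // => i _; rewrite scaler0.
Qed.

Definition modf_prod (A : nzRingType) (M N : modf A) : modf A :=
  Modf (finitely_generated_prod M N).

Section Submodules.
Variables (A : nzRingType) (M : lmodType A^c).
Implicit Types U V : set M.
Local Open Scope classical_set_scope.

Definition submodule U : Prop := submod_closed (mem U).

Definition maximal_submodule U : Prop :=
  [/\ submodule U, U <> setT &
      forall V, submodule V -> U `<=` V -> V <> setT -> V = U].

Definition direct_decomposition U V : Prop :=
  [/\ submodule U, submodule V, U `&` V = [set 0] &
      forall x, exists2 u, U u & exists2 v, V v & x = u + v].

Definition indecomposable : Prop :=
  (exists x : M, x <> 0) /\
  forall U V, direct_decomposition U V -> U = [set 0] \/ V = [set 0].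

End Submodules.

(* Nullary sums are [pretorsion0], binary ones [pretorsion_sum]; quotients are
   given up to isomorphism, as targets of surjective homomorphisms. *)
Record pretorsion_class (A : nzRingType) : Type := PretorsionClass {
  pretorsion_set :> modf A -> Prop;
  pretorsion_iso : forall (M N : modf A) (f : {linear M -> N}),
    bijective f -> pretorsion_set M -> pretorsion_set N;
  pretorsion0 : forall M : modf A, (forall x : M, x = 0) -> pretorsion_set M;
  pretorsion_quotient : forall (M N : modf A) (f : {linear M -> N}),
    (forall y : N, exists x : M, f x = y) ->
    pretorsion_set M -> pretorsion_set N;
  pretorsion_sum : forall M N : modf A,
    pretorsion_set M -> pretorsion_set N -> pretorsion_set (modf_prod M N)
}.

Section PretorsionLattice.
Variable A : nzRingType.
Implicit Types S T : pretorsion_class A.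

Lemma pretorsion_class_ext S T :
  (forall M, S M <-> T M) -> S = T.
Proof.
case: S T => [S ? ? ? ?] [T ? ? ? ?] /= eST.
have eqST : S = T by apply: funext => M; apply: propext.
by subst T; congr PretorsionClass; exact: Prop_irrelevance.
Qed.

Definition pretorsion_meet S T : pretorsion_class A.
Proof.
refine (@PretorsionClass A (fun M => S M /\ T M) _ _ _ _).
- by move=> M N f fb [SM TM]; split; apply: pretorsion_iso fb _.
- by move=> M M0; split; apply: pretorsion0.
- by move=> M N f fs [SM TM]; split; apply: pretorsion_quotient fs _.
- by move=> M N [SM TM] [SN TN]; split; apply: pretorsion_sum.
Defined.

Definition pretorsion_join S T : pretorsion_class A.
Proof.
refine (@PretorsionClass A
  (fun M => forall W : pretorsion_class A,
     (forall N, S N \/ T N -> W N) -> W M) _ _ _ _).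
- by move=> M N f fb SM W SW; apply: pretorsion_iso fb (SM W SW).
- by move=> M M0 W SW; apply: pretorsion0.
- by move=> M N f fs SM W SW; apply: pretorsion_quotient fs (SM W SW).
- by move=> M N SM SN W SW; apply: pretorsion_sum; [apply: SM|apply: SN].
Defined.

Definition pretorsion_le S T : Prop := forall M, S M -> T M.

Lemma pretorsion_le_refl S : pretorsion_le S S.
Proof. by []. Qed.

Lemma pretorsion_le_anti S T :
  pretorsion_le S T -> pretorsion_le T S -> S = T.
Proof.
by move=> ST TS; apply: pretorsion_class_ext => M; split; [apply: ST|apply: TS].
Qed.

Lemma pretorsion_le_trans S T W :
  pretorsion_le S T -> pretorsion_le T W -> pretorsion_le S W.
Proof. by move=> ST TW M /ST /TW. Qed.

Lemma pretorsion_meetP S T W :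
  pretorsion_le S (pretorsion_meet T W) <->
  pretorsion_le S T /\ pretorsion_le S W.
Proof.
split=> [STW|[ST SW] M SM]; first by split=> M /STW[].
by split; [apply: ST|apply: SW].
Qed.

Lemma pretorsion_joinP S T W :
  pretorsion_le (pretorsion_join S T) W <->
  pretorsion_le S W /\ pretorsion_le T W.
Proof.
split=> [STW|[SW TW] M]; last by apply=> N [/SW|/TW].
by split=> M SM; apply: STW => V SV; apply: SV; [left|right].
Qed.

End PretorsionLattice.

Definition pretorsion_lattice_distributive (A : nzRingType) : Prop :=
  forall R S T : pretorsion_class A,
    pretorsion_meet R (pretorsion_join S T) =
    pretorsion_join (pretorsion_meet R S) (pretorsion_meet R T).

(* Main.v *)
(** A condition "for every x there is y with x u_i = y v_i for all i" on right
    modules defines a pretorsion class. Distributivity, tested on a few such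
    classes and on explicit modules with two generators, shows that at most one
    arrow ends at each vertex of the quiver of A, i.e. every A e is uniserial, and
    that the radical of every local projective e A is x A (+) y A with x A and y A
    uniserial and J y = 0. For such an algebra, an isomorphism between simple
    submodules of two local modules L1 and L2 extends to L1 -> L2 or its inverse
    extends to L2 -> L1; algebraic closedness enters because the isomorphism is
    determined up to a scalar. Lifting a decomposition of M / Z, with Z simple, to
    one of M then shows that every module is a direct sum of local modules.
    Conversely, a local quotient of X (+) Y is a quotient of X or of Y, so when the
    indecomposable summands of a module in R /\ (S \/ T) are local, each of them
    lies in R /\ S or in R /\ T. *)

From HB Require Import structures.
Require Import Defs.
From mathcomp Require Import all_boot all_order all_algebra all_field.
From mathcomp Require Import generic_quotient ring_quotient.
From mathcomp Require Import boolp classical_sets.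

Set Implicit Arguments.
Unset Strict Implicit.
Unset Printing Implicit Defensive.

Import GRing.Theory.
Local Open Scope ring_scope.

(** * Radical and primitive idempotents *)

(** [A] is not assumed basic and no quiver presentation is chosen. An arrow is an element of [J]
    outside [J^2] cut down by primitive idempotents on both sides, and two idempotents count as the
    same vertex when some [e r f] lies outside [J]. Nilpotency of [J] replaces induction on the
    length of paths. What keeps computations finite is that an element of [e A e] is a scalar
    multiple of [e] modulo [J]: it acts on a socle vector by a scalar, and an equation [b = n b]
    with [n] in [J] forces [b = 0]. The join of two classes is never described on objects. To refute
    distributivity one exhibits a class [W] above [R /\ S] and [R /\ T], and a quotient of [X (+) Y]
    lying in [R] but not in [W]; solvability conditions work because solutions map forward along
    surjections and pair up in direct sums. Extending isomorphisms is what lifting needs: if [z]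
    lies in both [x_i A] and [x_j A], and [x_i A -> x_j A], given by [x_i |-> x_j r], fixes [z],
    then [x_i - x_j r] generates a summand that avoids [z]. *)

Lemma vspace_of_pred (k : fieldType) (V : vectType k) (P : V -> Prop) :
  P 0 -> (forall c u v, P u -> P v -> P (c *: u + v)) ->
  exists U : {vspace V}, forall v, v \in U <-> P v.
Proof.
move=> P0 PL.
(* A subspace inside [P] of maximal dimension is all of [P], since otherwise a further line could be
   added. *)
pose D d := `[< exists2 U : {vspace V}, (forall v, v \in U -> P v) & \dim U = d >].
have exD : exists d, D d.
  by exists 0%N; apply/asboolP; exists 0%VS; rewrite ?dimv0 // => v; rewrite memv0 => /eqP->.
have ubD d : D d -> (d <= \dim {:V})%N.
  by move=> /asboolP[U _ <-]; rewrite dimvS ?subvf.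
case: (ex_maxnP exD ubD) => d /asboolP[U UP dU] dmax.
exists U => v; split; first exact: UP.
move=> Pv; apply/negPn/negP => nUv.
have /dmax : D (\dim (U + <[v]>)%VS).
  apply/asboolP; exists (U + <[v]>)%VS => // w /memv_addP[u Uu [_ /vlineP[c ->] ->]].
  by rewrite addrC; apply: PL => //; apply: UP.
rewrite leqNgt -dU => /negP; apply; rewrite ltnNge.
apply/negP => le; have := addvSl U <[v]>%VS => sU.
move: nUv; have /eqP -> : U == (U + <[v]>)%VS by rewrite eqEdim sU.
by rewrite (subvP (addvSr _ _)) ?memv_line.
Qed.

(** Some coordinate is nonzero on the component of [v] off the subspace; normalised, it is the
    functional. The test modules are built from such functionals. *)
Lemma separating_functional (k : fieldType) (V : vectType k) (P : V -> Prop) (v : V) :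
  P 0 -> (forall c u w, P u -> P w -> P (c *: u + w)) -> ~ P v ->
  exists2 f : 'Hom(V, k^o), f v = 1 & forall u, P u -> f u = 0.
Proof.
move=> P0 PL nPv; have [U UP] := vspace_of_pred P0 PL.
have nUv : v \notin U by apply/negP => /UP.
pose w := v - projv U v.
have w0 : w != 0 by apply: contraNneq nUv => /subr0_eq ->; apply: memv_proj.
have [i wi] : exists i, coord (vbasis fullv) i w != 0.
  apply/existsP; rewrite -negb_forall; apply: contra w0 => /forallP w0.
  rewrite (coord_vbasis (memvf w)) big1 // => i _.
  by rewrite (eqP (w0 i)) scale0r.
pose g (u : V) : k^o :=
  (coord (vbasis fullv) i w)^-1 * coord (vbasis fullv) i (u - projv U u).
have gL : linear g.
  move=> c x y; rewrite /g linearP opprD addrACA -scalerBr linearP mulrDr.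
  by rewrite scalerAr.
pose GL := GRing.isLinear.Build _ _ _ _ g gL.
pose G : {linear V -> k^o} := HB.pack g GL.
exists (linfun G) => [|u /UP Uu]; rewrite lfunE /= /g.
  by rewrite mulVf.
by rewrite projv_id // subrr linear0 mulr0.
Qed.

Section Radical.
Variables (k : closedFieldType) (A : falgType k).
Implicit Types (U V W : {vspace A}) (a b e r s t : A).

(** Additivity of [P] suffices: the vectors all of whose multiples satisfy [P] form a subspace, and
    scalars are absorbed by the left factor. *)
Lemma prodv_closed U V (P : A -> Prop) :
  P 0 -> (forall u v, P u -> P v -> P (u + v)) ->
  (forall u v, u \in U -> v \in V -> P (u * v)) ->
  forall w, w \in (U * V)%VS -> P w.
Proof.
move=> P0 PD PM.
have [||W WP] := @vspace_of_pred _ A (fun w => forall c, P (c *: w)).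
- by move=> c; rewrite scaler0.
- by move=> c u v Pu Pv d; rewrite scalerDr scalerA; apply: PD.
move=> w UVw; rewrite -[w]scale1r; apply: (WP w).1; apply: subvP w UVw.
by apply/prodvP => u v Uu Vv; apply/WP => c; rewrite scalerAl; apply: PM; rewrite ?memvZ.
Qed.

Definition right_ideal U := forall u a, u \in U -> u * a \in U.

(** This says that [V / U] is a simple right module, without forming the quotient. *)
Definition covers U V := [/\ right_ideal U, right_ideal V, (U <= V)%VS, U <> V &
  forall W, right_ideal W -> (U <= W)%VS -> (W <= V)%VS -> W = U \/ W = V].

(* The annihilator of all composition factors of A, so that nilpotency is immediate. *)
Definition in_radical a :=
  forall U V, covers U V -> forall v, v \in V -> v * a \in U.

Lemma radical_ex : exists J : {vspace A}, forall a, a \in J <-> in_radical a.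
Proof.
apply: vspace_of_pred => [U V _ v _|c a b Ja Jb U V UV v Vv].
  by rewrite mulr0 mem0v.
by rewrite mulrDr -scalerAr memvD ?memvZ ?(Ja U V) ?(Jb U V).
Qed.

Definition radical : {vspace A} := projT1 (cid radical_ex).
Local Notation J := radical.

Lemma radicalP a : a \in J <-> in_radical a.
Proof. exact: (projT2 (cid radical_ex)). Qed.

Lemma radical_mull a b : b \in J -> a * b \in J.
Proof.
move=> /radicalP Jb; apply/radicalP => U V UV v Vv; rewrite mulrA.
by apply: (Jb U V UV); case: UV => _ rV _ _ _; apply: rV.
Qed.

Lemma radical_mulr a b : a \in J -> a * b \in J.
Proof.
move=> /radicalP Ja; apply/radicalP => U V UV v Vv; rewrite mulrA.
by have := Ja U V UV v Vv; case: UV => rU _ _ _ _; apply: rU.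
Qed.

Lemma covers_ex V : right_ideal V -> V <> 0%VS -> exists U, covers U V.
Proof.
move=> rV V0.
pose D d := `[< exists U, [/\ right_ideal U, (U <= V)%VS, U <> V & \dim U = d] >].
have exD : exists d, D d.
  exists 0%N; apply/asboolP; exists 0%VS; split; rewrite ?dimv0 ?sub0v //.
    by move=> u a; rewrite !memv0 => /eqP ->; rewrite mul0r.
  exact/nesym.
have ubD d : D d -> (d <= \dim V)%N by move=> /asboolP[U [_ UV _ <-]]; rewrite dimvS.
case: (ex_maxnP exD ubD) => d /asboolP[U [rU UV neUV dU]] dmax.
exists U; split=> // W rW UW WV; have [->|neWV] := pselect (W = V); [by right|left].
apply/esym/eqP; rewrite eqEdim UW dU dmax //.
by apply/asboolP; exists W.
Qed.

(** Right multiplication by [J] sends a nonzero right ideal into one that it covers, so the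
    dimension drops. *)
Lemma radical_nilpotent : exists n, (J ^+ n = 0)%VS.
Proof.
suff /(_ _ fullv (leqnn _)) [|n] : forall d V, (\dim V <= d)%N -> right_ideal V ->
    exists n, (V * J ^+ n = 0)%VS.
- by move=> u a _; apply: memvf.
- move=> Jn; exists n; apply/eqP; rewrite -subv0 -Jn -{1}(prod1v (J ^+ n)%VS).
  by rewrite prodvSl ?subvf.
elim=> [|d IHd] V.
  by rewrite leqn0 dimv_eq0 => /eqP-> _; exists 0%N; rewrite prod0v.
have [-> _ _|V0 dV rV] := pselect (V = 0%VS); first by exists 0%N; rewrite prod0v.
have [U UV] := covers_ex rV V0; have [rU _ sUV neUV _] := UV.
have [|//|n Un] := IHd U.
  rewrite -ltnS (leq_trans _ dV) // ltnNge; apply/negP => le.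
  by apply: neUV; apply/eqP; rewrite eqEdim sUV.
exists n.+1; apply/eqP; rewrite -subv0 -Un expvSl prodvA prodvSl //.
by apply/prodvP => v j Vv /radicalP Jj; apply: (Jj U V).
Qed.

Lemma radical_expr a n : a \in J -> a ^+ n \in (J ^+ n)%VS.
Proof.
move=> Ja; elim: n => [|n IHn]; first by rewrite expr0 expv0 memv_line.
by rewrite exprS expvSl memv_mul.
Qed.

Lemma radical_nil a : a \in J -> exists n, a ^+ n = 0.
Proof.
move=> Ja; have [n Jn] := radical_nilpotent; exists n.
by apply/eqP; rewrite -memv0 -Jn radical_expr.
Qed.

Lemma radical_fix_l a b : a \in J -> b = a * b -> b = 0.
Proof.
move=> /radical_nil[n an] ab; suff -> : b = a ^+ n * b by rewrite an mul0r.
by elim: n {an} => [|n IHn]; rewrite ?expr0 ?mul1r // exprSr -mulrA -ab.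
Qed.

Lemma radical_fix_r a b c : c \in J -> b = a * b * c -> b = 0.
Proof.
move=> /radical_nil[n cn] ab; suff -> : b = a ^+ n * b * c ^+ n by rewrite cn mulr0.
elim: n {cn} => [|n IHn]; rewrite ?expr0 ?mul1r ?mulr1 // {1}IHn.
by rewrite {1}ab exprSr (exprS c) !mulrA.
Qed.

Definition prim_idem e :=
  [/\ e * e = e, e != 0 & forall p, p * p = p -> e * p = p -> p * e = p -> p = 0 \/ p = e].

(** Fitting's lemma for left multiplication by [a]: once the chain [a^n A] is stable, [b = a^n] is
    injective on [b A], and [b = b b r] makes [p = b r] an idempotent with [b p = b]. A positive [n]
    lets [p] inherit [e p = p] from [e a = a]. *)
Lemma fitting_idem a : exists n p, [/\ p * p = p, (exists r, p = a ^+ n * r),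
  a ^+ n * p = a ^+ n, (forall x, a ^+ n * (p * x) = 0 -> p * x = 0) & (0 < n)%N].
Proof.
pose V n := (amull (a ^+ n) @: fullv)%VS.
have VS n : (V n.+1 <= V n)%VS.
  apply/subvP => _ /memv_imgP[r _ ->]; rewrite lfunE /= exprSr -mulrA.
  by apply/memv_imgP; exists (a * r); rewrite ?memvf // lfunE.
have Vle n m : (n <= m)%N -> (V m <= V n)%VS.
  by move=> /subnKC <-; elim: (m - n)%N => [|l IH]; rewrite ?addn0 // addnS (subv_trans (VS _)).
have [n n0 Vn] : exists2 n, (0 < n)%N & V n = V (n + n)%N.
  pose D d := `[< exists2 n, (0 < n)%N & \dim (V n) = d >].
  have exD : exists d, D d by exists (\dim (V 1%N)); apply/asboolP; exists 1%N.
  case: (ex_minnP exD) => d /asboolP[n n0 dn] dmin; exists n => //.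
  apply/eqP; rewrite eq_sym eqEdim Vle ?leq_addr //= dn dmin //.
  by apply/asboolP; exists (n + n)%N => //; rewrite addn_gt0 n0.
set b := a ^+ n in Vn *.
have : b \in V n by apply/memv_imgP; exists 1; rewrite ?memvf // lfunE /= mulr1.
rewrite Vn => /memv_imgP[r _]; rewrite lfunE /= exprD => br.
have bK x : b * (b * x) = 0 -> b * x = 0.
  move=> bbx.
  (* Left multiplication by [b] maps [V n] onto [V (n + n) = V n], so by rank and nullity its kernel
     there is zero. *)
  have : (V n :&: lker (amull b))%VS = 0%VS.
    apply/eqP; rewrite -dimv_eq0 -(eqn_add2r (\dim (amull b @: V n))).
    rewrite limg_ker_dim add0n; apply/eqP; congr (\dim _).
    rewrite [LHS]Vn /V; apply/vspaceP => y; apply/idP/idP => /memv_imgP[].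
      move=> z _ ->; apply/memv_imgP; exists (b * z); rewrite ?lfunE /= ?exprD ?mulrA //.
      by apply/memv_imgP; exists z; rewrite ?memvf ?lfunE.
    move=> x' /memv_imgP[z _ ->] ->; apply/memv_imgP; exists z; rewrite ?memvf //.
    by rewrite !lfunE /= exprD mulrA.
  move/vspaceP/(_ (b * x)); rewrite memv0 memv_cap memv_ker lfunE /= bbx eqxx andbT.
  by move=> bx0; apply/eqP; rewrite -bx0; apply/memv_imgP; exists x; rewrite ?memvf ?lfunE.
pose p := b * r.
have bp : b * p = b by rewrite /p mulrA -br.
exists n, p; split=> //.
- have : b * (b * (r * p - r)) = 0.
    by rewrite mulrBr mulrBr !mulrA -[b * b * r]mulrA -/p -mulrA bp !mulrA -[b * b * r]mulrA -/p bp subrr.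
  by move=> /bK; rewrite mulrBr mulrA -/p => /subr0_eq.
- by exists r.
- by move=> x; rewrite /p -mulrA; apply: bK.
Qed.

(** The Fitting idempotent lies in [e A e], so it is 0, and [a] is nilpotent, or it is [e], and [a]
    is invertible. *)
Lemma fitting e a : prim_idem e -> e * a = a -> a * e = a ->
  (exists n, a ^+ n = 0) \/
  (exists r, [/\ a * r = e, r * a = e, e * r = r & r * e = r]).
Proof.
case=> ee e0 prim ea ae; have [[|n] [p [pp [r pr] bp inj //]]] := fitting_idem a; move=> _.
have ep : e * p = p by rewrite pr mulrA exprS mulrA ea.
have pe : p * e = p.
  apply/subr0_eq; rewrite -{2}[p]mulr1 -mulrBr; apply: inj.
  by rewrite mulrA bp mulrBr mulr1 exprSr -mulrA ae subrr.
have [p0|pe'] := prim p pp ep pe; first by left; exists n.+1; rewrite -bp p0 mulr0.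
right; pose t := e * (a ^+ n * r) * e.
have et : e * t = t by rewrite /t !mulrA ee.
have te : t * e = t by rewrite /t -!mulrA ee.
have at' : a * t = e by rewrite /t !mulrA ae -exprS -pr pe.
exists t; split=> //.
(* [t a] is an idempotent of [e A e], and it is nonzero because [a (t a) t = e]. *)
have [|||ta|//] := prim (t * a).
- by rewrite mulrA -(mulrA t) at' te.
- by rewrite mulrA et.
- by rewrite -mulrA ae.
case/eqP: e0; have <- : a * (t * a) * t = e by rewrite mulrA at' -mulrA at' ee.
by rewrite ta mulr0 mul0r.
Qed.

(** If every [a s] is nilpotent, [a] kills each simple factor [V / U]: with [v a] outside [U] one
    gets [v = u + v a s], so [v] equals [v (a s)^n] modulo [U] for all [n] and lies in [U]. *)
Lemma notin_radical a : a \notin J ->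
  exists s, (forall n, (a * s) ^+ n <> 0) /\ (forall n, (s * a) ^+ n <> 0).
Proof.
move=> /negP nJ; have [s] : exists s, forall n, (a * s) ^+ n <> 0.
  apply: contra_notP nJ => nil; apply/radicalP => U V UV v Vv.
  case: (UV) => rU rV sUV neUV maxU; apply/negPn/negP => nUva.
  pose W := (U + (amull (v * a) @: fullv))%VS.
  have rW : right_ideal W.
    move=> _ b /memv_addP[u Uu [_ /memv_imgP[x _ ->] ->]]; rewrite mulrDl lfunE /=.
    apply/memv_addP; exists (u * b); first exact: rU.
    exists (v * a * x * b) => //; apply/memv_imgP; exists (x * b); rewrite ?memvf //.
    by rewrite lfunE /= !mulrA.
  have Wva : v * a \in W.
    apply: (subvP (addvSr _ _)); apply/memv_imgP; exists 1; rewrite ?memvf //.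
    by rewrite lfunE /= mulr1.
  have [||eW|eW] := maxU W rW; rewrite ?addvSl //.
  - apply/subvP => _ /memv_addP[u Uu [_ /memv_imgP[x _ ->] ->]]; rewrite lfunE /= -mulrA.
    by apply: memvD; [apply: (subvP sUV)|apply: rV].
  - by rewrite eW (negPf nUva) in Wva.
  have : v \in W by rewrite eW.
  move=> /memv_addP[u Uu [_ /memv_imgP[s _ ->] vE]]; rewrite lfunE /= -mulrA in vE.
  have vas : v * (a * s) - v \in U by rewrite {2}vE opprD addrC addrNK memvN.
  have powU n : v * (a * s) ^+ n - v \in U.
    elim: n => [|n IHn]; first by rewrite expr0 mulr1 subrr mem0v.
    rewrite (_ : _ - v = (v * (a * s) ^+ n - v) * (a * s) + (v * (a * s) - v)).
      by rewrite memvD ?rU.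
    by rewrite mulrBl -mulrA -exprSr addrA addrNK.
  have [n asn] : exists n, (a * s) ^+ n = 0.
    by apply: contrapT => h; apply: nil; exists s => n asn; apply: h; exists n.
  have := powU n; rewrite asn mulr0 sub0r memvN => Uv.
  by move: nUva; rewrite rU.
move=> h; exists s; split=> // n san; apply: (h n.+1).
suff -> : (a * s) ^+ n.+1 = a * (s * a) ^+ n * s by rewrite san mulr0 mul0r.
by elim: n {san h} => [|n IHn]; rewrite ?expr1 ?expr0 ?mulr1 // exprSr IHn [in RHS]exprSr !mulrA.
Qed.

(** Nilpotency of the corner element [c e] passes to [c]. *)
Lemma exprS_idl e c n : e * c = c -> c ^+ n.+1 = (c * e) ^+ n * c.
Proof.
move=> ec; elim: n => [|n IHn]; first by rewrite expr1 expr0 mul1r.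
have eX : e * c ^+ n.+1 = c ^+ n.+1 by rewrite exprS mulrA ec.
by rewrite [LHS]exprS [in RHS]exprS -!mulrA -IHn eX.
Qed.

Lemma exprS_idr e c n : c * e = c -> c ^+ n.+1 = c * (e * c) ^+ n.
Proof.
move=> ce; elim: n => [|n IHn]; first by rewrite expr1 expr0 mulr1.
have eX : c ^+ n.+1 * e = c ^+ n.+1 by rewrite exprSr -mulrA ce.
by rewrite [LHS]exprSr [in RHS]exprSr mulrA -IHn mulrA eX.
Qed.

Lemma right_inv e a : prim_idem e -> e * a = a -> a \notin J -> exists r, a * r = e.
Proof.
move=> pe ea /notin_radical[s [nas _]]; have [ee _ _] := pe.
have [||[n asn]|[r [asr _ _ _]]] := fitting (a := a * s * e) pe.
- by rewrite !mulrA ea.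
- by rewrite -mulrA ee.
- by case: (nas n.+1); rewrite (@exprS_idl e) ?asn ?mul0r // mulrA ea.
by exists (s * e * r); rewrite !mulrA.
Qed.

Lemma left_inv e a : prim_idem e -> a * e = a -> a \notin J -> exists r, r * a = e.
Proof.
move=> pe ae /notin_radical[s [_ nsa]]; have [ee _ _] := pe.
have [||[n san]|[r [_ rsa _ _]]] := fitting (a := e * (s * a)) pe.
- by rewrite mulrA ee.
- by rewrite -!mulrA ae.
- by case: (nsa n.+1); rewrite (@exprS_idr e) ?san ?mulr0 // -mulrA ae.
by exists (r * e * s); rewrite -!mulrA.
Qed.

Lemma prim_notin e : prim_idem e -> e \notin J.
Proof.
move=> [ee e0 _]; apply/negP => /radical_nil[n en]; case/eqP: e0.
have <- : e ^+ n.+1 = e by elim: n {en} => [|n IHn]; rewrite ?expr1 // exprS IHn.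
by rewrite exprS en mulr0.
Qed.

(** A polynomial killing [a] splits over [k]. If every [a - c e] were outside [J], each linear
    factor would act injectively on [e A], and so would their product, which kills [e]. *)
Lemma scalar_mod_radical e a : prim_idem e -> e * a = a -> a * e = a ->
  exists c : k, a - c *: e \in J.
Proof.
move=> pe ea ae; have [ee e0 _] := pe.
have [P P0 Pa] : exists2 P : {poly k}, P != 0 & horner_alg a P = 0.
  pose n := \dim {:A}; pose X := [tuple a ^+ i | i < n.+1].
  have : ~~ free X.
    by apply/negP => /eqP fX; have := dimvS (subvf <<X>>%VS); rewrite fX size_tuple ltnn.
  move=> /negP nfX; have [c cX [i ci]] : exists2 c : 'I_n.+1 -> k,
      \sum_(i < n.+1) c i *: X`_i = 0 & exists i, c i <> 0.
    apply: contra_notP nfX => h; apply/freeP => c cX i.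
    by apply: contrapT => ci; apply: h; exists c => //; exists i.
  exists (\poly_(i < n.+1) c (inord i)).
    apply/eqP => /polyP/(_ i); rewrite coef_poly ltn_ord coef0 inord_val.
    exact: ci.
  rewrite poly_def rmorph_sum -[RHS]cX; apply: eq_bigr => j _.
  by rewrite -mul_polyC rmorphM rmorphXn /= horner_algC horner_algX mulr_algl inord_val (nth_mktuple _ _ j).
have [s Ps] := closed_field_poly_normal P.
have : exists2 c, c \in s & a - c *: e \in J; last by case=> c _ ?; exists c.
apply: contrapT => h.
suff inj : forall x, e * x = x -> x <> 0 ->
    let y := horner_alg a (\prod_(z <- s) ('X - z%:P)) * x in e * y = y /\ y <> 0.
  have [||_] := inj e; rewrite ?ee //; first exact/eqP.
  apply; move: Pa; rewrite Ps -mul_polyC rmorphM /= horner_algC mulr_algl.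
  move=> /eqP; rewrite scaler_eq0 lead_coef_eq0 (negPf P0).
  by move=> /eqP ->; rewrite mul0r.
elim: s {Ps} h => [|c s IHs] h x ex x0.
  by rewrite big_nil rmorph1 mul1r.
rewrite big_cons rmorphM -mulrA; set y := _ * x.
have [] := IHs _ x ex x0; first by case=> d ds hd; apply: h; exists d; rewrite ?inE ?ds ?orbT.
rewrite -/y => ey y0; rewrite rmorphB /= horner_algX horner_algC.
have -> : (a - c%:A) * y = (a - c *: e) * y by rewrite !mulrBl -!scalerAl mul1r ey.
have eae : e * (a - c *: e) = a - c *: e by rewrite mulrBr -scalerAr ea ee.
split; first by rewrite mulrA eae.
have nJ : a - c *: e \notin J by apply/negP => hJ; apply: h; exists c; rewrite ?mem_head.
have be : (a - c *: e) * e = a - c *: e by rewrite mulrBl -scalerAl ae ee.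
have [[n bn]|[r [_ rb _ _]]] := fitting pe eae be.
  have [r br] := right_inv pe eae nJ.
  have : (a - c *: e) ^+ n.+1 * (r * e) ^+ n.+1 = e.
    have bt : (a - c *: e) * (r * e) = e by rewrite mulrA br ee.
    elim: n {bn} => [|n IHn]; first by rewrite !expr1 bt.
    rewrite exprSr (exprS (r * e)) -mulrA (mulrA (a - c *: e)) bt mulrA.
    by rewrite {1}exprSr -(mulrA _ _ e) be -exprSr IHn.
  by rewrite exprS bn mulr0 mul0r => e0'; case/eqP: e0.
by move=> by0; apply: y0; rewrite -ey -rb -mulrA by0 mulr0.
Qed.

Lemma prim_decomposition : exists s : seq A,
  (forall e, e \in s -> prim_idem e) /\ \sum_(e <- s) e = 1.
Proof.
suff main d e : (\dim (amull e @: fullv) <= d)%N -> e * e = e ->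
  exists s : seq A, (forall e, e \in s -> prim_idem e) /\ \sum_(x <- s) x = e.
  by apply: (main _ 1 (leqnn _)); rewrite mulr1.
elim: d e => [|d IHd] e dimd ee.
  exists [::]; rewrite big_nil; split=> //.
  move: dimd; rewrite leqn0 dimv_eq0 => /eqP e0; apply/esym/eqP.
  rewrite -memv0 -e0; apply/memv_imgP; exists 1; rewrite ?memvf //.
  by rewrite lfunE /= mulr1.
have [->|e0] := eqVneq e 0; first by exists [::]; rewrite big_nil.
have [pe|npe] := pselect (prim_idem e).
  by exists [:: e]; rewrite big_seq1; split=> // x; rewrite inE => /eqP->.
have [p [pp ep pe p0 pne]] : exists p, [/\ p * p = p, e * p = p, p * e = p, p <> 0 & p <> e].
  apply: contra_notP npe => h; split=> // p pp ep pe.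
  by apply: contrapT => /not_orP[p0 pne]; apply: h; exists p.
have smaller q : q * q = q -> e * q = q -> q * e = q -> q <> e ->
    (\dim (amull q @: fullv) <= d)%N.
  move=> qq eq qe qne; rewrite -ltnS (leq_trans _ dimd) // ltnNge; apply/negP => le.
  apply: qne; have sub : (amull q @: fullv <= amull e @: fullv)%VS.
    apply/subvP => _ /memv_imgP[x _ ->]; apply/memv_imgP; exists (q * x); rewrite ?memvf //.
    by rewrite !lfunE /= mulrA eq.
  have : e \in (amull q @: fullv)%VS.
    have /eqP -> : (amull q @: fullv)%VS == (amull e @: fullv)%VS by rewrite eqEdim sub le.
    by apply/memv_imgP; exists 1; rewrite ?memvf // lfunE /= mulr1.
  move=> /memv_imgP[x _]; rewrite lfunE /= => eqx.
  by rewrite -[LHS]qe {1}eqx mulrA qq -eqx.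
have eqe : e * (e - p) = e - p by rewrite mulrBr ee ep.
have qee : (e - p) * e = e - p by rewrite mulrBl ee pe.
have qq : (e - p) * (e - p) = e - p by rewrite mulrBl eqe mulrBr pe pp subrr subr0.
have [|//|s [ps sp]] := IHd p; first exact: smaller.
have [|//|t [pt tq]] := IHd (e - p).
  by apply: smaller => // /eqP; rewrite -subr_eq0 addrC addKr oppr_eq0 => /eqP.
exists (s ++ t); split; last by rewrite big_cat /= sp tq addrC subrK.
by move=> x; rewrite mem_cat => /orP[/ps|/pt].
Qed.
End Radical.

(** * Arrows of the quiver *)

Section LeftSerial.
Variables (k : closedFieldType) (A : falgType k).
Implicit Types (a b e f r s t : A).
Local Notation J := (radical A).

(** The exponent is a successor because [J ^+ 0] is the line spanned by 1, in general not an
    ideal. *)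
Lemma radicalX_mulr n a b : a \in (J ^+ n.+1)%VS -> a * b \in (J ^+ n.+1)%VS.
Proof.
rewrite expvSr; elim/prodv_closed : a / => [|u v|u v uJ vJ]; last 1 first.
- by rewrite -mulrA memv_mul ?radical_mulr.
- by rewrite mul0r mem0v.
by rewrite mulrDl; apply: memvD.
Qed.

Lemma radicalX_mull n a b : a \in (J ^+ n.+1)%VS -> b * a \in (J ^+ n.+1)%VS.
Proof.
rewrite expvSl; elim/prodv_closed : a / => [|u v|u v uJ vJ]; last 1 first.
- by rewrite mulrA memv_mul ?radical_mull.
- by rewrite mulr0 mem0v.
by rewrite mulrDr; apply: memvD.
Qed.

Lemma radicalXS m n : (m <= n)%N -> (J ^+ n.+1 <= J ^+ m.+1)%VS.
Proof.
move=> /subnKC <-; elim: (n - m)%N => [|d IHd]; first by rewrite addn0.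
apply: subv_trans IHd; rewrite addnS [X in (X <= _)%VS]expvSr.
by apply/prodvP => u v uJ _; apply: radicalX_mulr.
Qed.

Lemma radicalX_eq0 a : (forall n, a \in (J ^+ n.+1)%VS) -> a = 0.
Proof.
move=> aJ; have [n Jn] := radical_nilpotent A.
by apply/eqP; rewrite -memv0 -(prod0v J) -Jn -expvSr aJ.
Qed.

Lemma memv_radicalD m n a b : a \in (J ^+ m)%VS -> b \in (J ^+ n)%VS ->
  a * b \in (J ^+ (m + n))%VS.
Proof. by move=> ? ?; rewrite expvD memv_mul. Qed.

Lemma prim_split (X : A -> Prop) a : X 0 -> (forall u v, X u -> X v -> X (u + v)) ->
  ~ X a -> exists2 f, prim_idem f & ~ X (a * f).
Proof.
move=> X0 XD nXa; have [s [ps s1]] := prim_decomposition A.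
apply: contrapT => h; apply: nXa; rewrite -[a]mulr1 -s1 mulr_sumr big_seq.
elim/big_ind: _ => // f fs; apply: contrapT => nX; apply: h.
by exists f => //; apply: ps.
Qed.

(** Successive approximation: an error in [J^n J] is corrected modulo [J^(n+2)] by applying the
    hypothesis to its right factor, until nilpotency ends the process. *)
Lemma nakayama_left f x : f * f = f -> x * f = x ->
  (forall b, b \in J -> b * f = b -> exists r, b - r * x \in (J ^+ 2)%VS) ->
  forall b, b \in J -> b * f = b -> exists r, b = r * x.
Proof.
move=> ff xf gen b bJ bf.
suff main n : exists r, b - r * x \in (J ^+ n.+1)%VS.
  have [n Jn] := radical_nilpotent A; have [r] := main n.
  by rewrite expvSr Jn prod0v memv0 => /eqP/subr0_eq ->; exists r.
elim: n => [|n [r IHn]]; first by exists 0; rewrite mul0r subr0.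
suff [r' hr'] : exists r', (b - r * x) * f - r' * x \in (J ^+ n.+2)%VS.
  exists (r + r'); move: hr'; rewrite mulrBl bf -mulrA xf.
  by rewrite mulrDl opprD addrA.
rewrite expvSr in IHn; elim/prodv_closed: (b - _) / IHn => [|u v [p hp] [q hq]|u v uJ vJ].
- by exists 0; rewrite !mul0r subr0 mem0v.
- by exists (p + q); rewrite !mulrDl opprD addrACA memvD.
have [||p pJ] := gen (v * f); rewrite ?radical_mulr // -?mulrA ?ff //.
by exists (u * p); rewrite -!mulrA -mulrBr -addn2 memv_radicalD // mulrA.
Qed.

Lemma nakayama_right e x y : e * e = e -> e * x = x -> e * y = y ->
  (forall b, b \in J -> e * b = b -> exists s t, b - (x * s + y * t) \in (J ^+ 2)%VS) ->
  forall b, b \in J -> e * b = b -> exists s t, b = x * s + y * t.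
Proof.
move=> ee ex ey gen b bJ eb.
suff main n : exists s t, b - (x * s + y * t) \in (J ^+ n.+1)%VS.
  have [n Jn] := radical_nilpotent A; have [s [t]] := main n.
  by rewrite expvSr Jn prod0v memv0 => /eqP/subr0_eq ->; exists s, t.
elim: n => [|n [s [t IHn]]]; first by exists 0, 0; rewrite !mulr0 addr0 subr0.
suff [s' [t' h]] : exists s' t',
    e * (b - (x * s + y * t)) - (x * s' + y * t') \in (J ^+ n.+2)%VS.
  exists (s + s'), (t + t'); move: h; rewrite mulrBr eb mulrDr !mulrA ex ey.
  by rewrite -addrA -opprD !mulrDr (addrACA (x * s)).
rewrite expvSl in IHn; elim/prodv_closed: (b - _) / IHn => [|u v [p [q h]] [p' [q' h']]|u v uJ vJ].
- by exists 0, 0; rewrite !mulr0 addr0 subr0 mem0v.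
- exists (p + p'), (q + q'); rewrite !mulrDr addrACA opprD addrACA; exact: memvD.
have [||p [q h]] := gen (e * u); rewrite ?radical_mull // ?mulrA ?ee //.
by exists (p * v), (q * v); rewrite !mulrA -mulrDl -mulrBl -[n.+2]/(2 + n)%N memv_radicalD.
Qed.

(* In the quiver of A: at most one arrow ends at each vertex. *)
Definition left_serial := forall f, prim_idem f -> exists e x,
  [/\ prim_idem e, x \in J, e * x = x, x * f = x &
      forall b, b \in J -> b * f = b -> exists r, b = r * x].

(* The test module violating this has two generators x1, x2 with x1 b = 0,
   x2 a = 0 and x1 a = x2 b nonzero. *)
Definition no_double_arrow := forall f a b, prim_idem f -> a \in J -> b \in J ->
  a * f = a -> b * f = b ->
  (exists r, a - r * b \in (J ^+ 2)%VS) \/ (exists r, b - r * a \in (J ^+ 2)%VS).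

(** One element [e x] outside [J^2] is compared with each [e' b]. If it is [e x] that is a multiple
    modulo [J^2], the coefficient is outside [J] and can be inverted. *)
Lemma no_double_arrow_serial : no_double_arrow -> left_serial.
Proof.
move=> KR f pf; have [ff _ _] := pf.
have [Jf|nJf] := pselect (forall b, b \in J -> b * f = b -> b \in (J ^+ 2)%VS).
  (* No arrow ends at [f]; then 0 generates [J f]. *)
  exists f, 0; split; rewrite ?mem0v ?mulr0 ?mul0r //.
  by apply: nakayama_left => //; [rewrite mul0r|move=> b bJ bf; exists 0; rewrite mul0r subr0; exact: Jf].
have [x [xJ xf nx]] : exists x, [/\ x \in J, x * f = x & x \notin (J ^+ 2)%VS].
  by apply: contra_notP nJf => h b bJ bf; apply: contrapT => /negP nb; apply: h; exists b.
have [s [ps s1]] := prim_decomposition A.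
have [e pe ne] : exists2 e, prim_idem e & e * x \notin (J ^+ 2)%VS.
  apply: contrapT => h; case/negP: nx; rewrite -[x]mul1r -s1 mulr_suml big_seq.
  apply: memv_suml => e es; apply: contrapT => /negP ne; apply: h; exists e => //; exact: ps.
have [ee _ _] := pe.
exists e, (e * x); split; rewrite ?radical_mull ?mulrA ?ee -?mulrA ?xf //.
apply: nakayama_left => //; first by rewrite -mulrA xf.
move=> b bJ bf.
have main e' c : prim_idem e' -> c \in J -> c * f = c -> e' * c = c ->
    exists r, c - r * (e * x) \in (J ^+ 2)%VS.
  move=> pe' cJ cf ec; have [ee' _ _] := pe'.
  have [||||[r hr]|//] := KR f (e * x) c pf; rewrite ?radical_mull //.
    by rewrite -mulrA xf.
  have exE : e * x - e * r * e' * c = e * (e * x - r * c).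
    by rewrite mulrBr !mulrA ee -!mulrA ec.
  have er : e * r * e' \notin J.
    apply: contraNN ne => rJ; rewrite -[e * x](subrK (e * r * e' * c)) memvD //.
      by rewrite exE radicalX_mull.
    by rewrite expv2 memv_mul.
  have [|t te] := left_inv pe' _ er; first by rewrite -mulrA ee'.
  exists t; rewrite -memvN opprB -ec -te -!mulrA -mulrBr radicalX_mull //.
  by rewrite !mulrA exE radicalX_mull.
suff [r hr] : exists r, \sum_(e' <- s) e' * b - r * (e * x) \in (J ^+ 2)%VS.
  by exists r; rewrite -mulr_suml s1 mul1r in hr.
rewrite big_seq; elim/big_ind: _ => [|u v [p hp] [q hq]|e' es].
- by exists 0; rewrite mul0r subr0 mem0v.
- by exists (p + q); rewrite !mulrDl opprD addrACA memvD.
by have [ee' _ _] := ps _ es; apply: (main e'); rewrite ?radical_mull -?mulrA ?bf ?mulrA ?ee' //; exact: ps.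
Qed.

(** Elements of [J f] are multiples of the arrow into [f], so the comparison moves to their
    coefficients in [A e]. The third alternative counts these moves and finally makes both elements
    zero. *)
Lemma left_serial_comparable : left_serial -> forall f a b, prim_idem f ->
  a * f = a -> b * f = b -> (exists r, a = r * b) \/ (exists r, b = r * a).
Proof.
move=> LS.
suff main n : forall f a b, prim_idem f -> a * f = a -> b * f = b ->
    [\/ exists r, a = r * b, exists r, b = r * a | a \in (J ^+ n.+1)%VS /\ b \in (J ^+ n.+1)%VS].
  move=> f a b pf af bf; have [n Jn] := radical_nilpotent A.
  have [?|?|[_]] := main n f a b pf af bf; [by left|by right|].
  by rewrite expvSr Jn prod0v memv0 => /eqP ->; right; exists 0; rewrite mul0r.
have unit f a b : prim_idem f -> a * f = a -> b * f = b -> a \notin J -> exists r, b = r * a.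
  move=> pf af bf nJ; have [r rf] := left_inv pf af nJ.
  by exists (b * r); rewrite -mulrA rf bf.
elim: n => [|n IHn] f a b pf af bf.
  have [aJ|/(unit f a b pf af bf)] := boolP (a \in J); last by constructor 2.
  have [bJ|/(unit f b a pf bf af)] := boolP (b \in J); last by constructor 1.
  by constructor 3.
have [aJ|/(unit f a b pf af bf)] := boolP (a \in J); last by constructor 2.
have [bJ|/(unit f b a pf bf af)] := boolP (b \in J); last by constructor 1.
have [e [x [pe xJ ex xf gen]]] := LS f pf; have [ee _ _] := pe.
have [r ar] := gen a aJ af; have [t bt] := gen b bJ bf.
have [||||] := IHn e (r * e) (t * e) pe; rewrite -?mulrA ?ee //.
- by move=> [p rp]; constructor 1; exists p; rewrite ar bt -ex !mulrA rp !mulrA.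
- by move=> [p rp]; constructor 2; exists p; rewrite ar bt -ex !mulrA rp !mulrA.
move=> [rJ tJ]; constructor 3; rewrite ar bt -ex !mulrA.
by rewrite expvSr !memv_mul.
Qed.

(** * Arrows starting at a vertex *)

Section Arms.
Hypothesis LS : left_serial.

(* The arrows starting at e are x and y, and J y = 0 says that the arrow ending
   at e does not compose with y. *)
Definition arms e x y := [/\ [/\ x \in J, y \in J, e * x = x & e * y = y],
  exists2 f, prim_idem f & x * f = x, exists2 f, prim_idem f & y * f = y,
  forall b, b \in J -> e * b = b -> exists s t, b = x * s + y * t &
  (forall s t, x * s = y * t -> x * s = 0) /\ (forall j, j \in J -> j * y = 0)].

Lemma arrow_generates f x : prim_idem f -> x \in J -> x * f = x -> x \notin (J ^+ 2)%VS ->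
  forall b, b \in J -> b * f = b -> exists r, b = r * x.
Proof.
move=> pf xJ xf nx; have [e [z [pe zJ ez zf gen]]] := LS pf; have [ee _ _] := pe.
have [r xr] := gen x xJ xf.
have nr : r * e \notin J.
  by apply: contraNN nx => rJ; rewrite xr -ez mulrA expv2 memv_mul.
have [|t te] := left_inv pe _ nr; first by rewrite -mulrA ee.
move=> b bJ bf; have [q ->] := gen b bJ bf; exists (q * t).
by rewrite -mulrA xr -{1}ez -{1}te -!mulrA ez.
Qed.

(** If [x = y s] modulo [J^2], either [f s] is in [J] and [x] is in [J^2], or [f s] has a right
    inverse and [y] is a right multiple of [x] modulo [J^2]. *)
Lemma not_factor_sym e f x y : prim_idem e -> prim_idem f -> x * e = x -> y * f = y ->
  x \in J -> y \in J -> x \notin (J ^+ 2)%VS ->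
  (forall s, y - x * s \notin (J ^+ 2)%VS) -> forall s, x - y * s \notin (J ^+ 2)%VS.
Proof.
move=> pe pf xe yf xJ yJ nx ny s; apply/negP => hs; have [ff _ _] := pf.
have [sJ|nsJ] := boolP (f * s \in J).
  case/negP: nx; rewrite -[x](subrK (y * s)) memvD // -yf -mulrA expv2 memv_mul //.
have [|t ft] := right_inv pf _ nsJ; first by rewrite mulrA ff.
case/negP: (ny t); rewrite -memvN opprB -yf -ft !mulrA yf -mulrBl radicalX_mulr //.
Qed.

(** [y v] lies in [J f], so it is a left multiple of [x] with coefficient in [e A e]. A nonzero
    scalar part [c] of that coefficient would give [x = c^-1 y v] modulo [J^2]. *)
Lemma arrow_cross e f g x y : prim_idem e -> prim_idem f ->
  e * x = x -> e * y = y -> x * f = x -> y * g = y ->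
  x \in J -> y \in J -> x \notin (J ^+ 2)%VS ->
  (forall s, x - y * s \notin (J ^+ 2)%VS) ->
  forall v, v * f = v -> exists2 n, n \in J & y * v = n * x.
Proof.
move=> pe pf ex ey xf yg xJ yJ nx ny v vf; have [ee _ _] := pe.
have [||n yv] := arrow_generates pf xJ xf nx (b := y * v).
- by rewrite radical_mulr.
- by rewrite -mulrA vf.
have ynE : y * v = (e * n * e) * x by rewrite -mulrA ex -mulrA -yv mulrA ey.
exists (e * n * e) => //.
have [||c cJ] := scalar_mod_radical (a := e * n * e) pe; rewrite ?mulrA ?ee -?mulrA ?ee //.
have [c0|c0] := eqVneq c 0; first by move: cJ; rewrite c0 scale0r subr0 -mulrA.
case/negP: (ny (c^-1 *: v)).
rewrite -scalerAr ynE -[X in X - _](scalerK c0) -scalerBr memvZ //.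
rewrite -memvN opprB -[in X in _ - X]ex scalerAl -mulrBl expv2 memv_mul //.
Qed.

(* The local module P = e A / (J^m a1 + ...) has a1 A, a2 A, a3 A in its socle;
   when these are independent, P / a1 A and P / a2 A glued along a3 A form an
   indecomposable module with two generators. *)
Definition no_three_socle := forall e a1 a2 a3 m m', (m' <= m)%N -> prim_idem e ->
  e * a1 = a1 -> e * a2 = a2 -> e * a3 = a3 ->
  (forall n, n \in J -> [/\ n * a1 \in (J ^+ m.+1)%VS, n * a2 \in (J ^+ m.+1)%VS &
                            n * a3 \in (J ^+ m'.+1)%VS]) ->
  ~ [/\ forall p q, a1 - (a2 * p + a3 * q) \notin (J ^+ m.+1)%VS,
        forall p q, a2 - (a1 * p + a3 * q) \notin (J ^+ m.+1)%VS &
        forall p q, a3 - (a1 * p + a2 * q) \notin (J ^+ m'.+1)%VS].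

(* Excludes an arrow z from e to f that composes with two arrows x, y, provided
   that e and f are not isomorphic: the test module has two generators u at e and
   v at f, with u z x = v x, v y = 0 and u z y nonzero. *)
Definition no_branching := forall e f z x y, prim_idem e -> prim_idem f ->
  z \in J -> e * z = z -> z * f = z -> (forall r, exists t, e * r * f = t * z) ->
  x \in J -> y \in J -> f * x = x -> f * y = y ->
  ~ [/\ forall p, z * x - z * y * p \notin (J ^+ 3)%VS &
        forall p, z * y - z * x * p \notin (J ^+ 3)%VS].

Section TwoArrows.
Variables e f g x y : A.
Hypotheses (pe : prim_idem e) (pf : prim_idem f) (pg : prim_idem g).
Hypotheses (xJ : x \in J) (yJ : y \in J) (ex : e * x = x) (ey : e * y = y).
Hypotheses (xf : x * f = x) (yg : y * g = y).
Hypotheses (nx : x \notin (J ^+ 2)%VS) (ny : forall s, y - x * s \notin (J ^+ 2)%VS).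

Let nxy : forall s, x - y * s \notin (J ^+ 2)%VS.
Proof. exact: (not_factor_sym pf pg xf yg xJ yJ nx ny). Qed.

Let ny0 : y \notin (J ^+ 2)%VS.
Proof. by have := ny 0; rewrite mulr0 subr0. Qed.

Let crossy v : v * f = v -> exists2 n, n \in J & y * v = n * x.
Proof. exact: (arrow_cross pe pf ex ey xf yg xJ yJ nx nxy). Qed.

Let crossx v : v * g = v -> exists2 n, n \in J & x * v = n * y.
Proof. exact: (arrow_cross pe pg ey ex yg xf yJ xJ ny0 ny). Qed.

(** The right factors are comparable in [A h]; crossing the quotient over the other arrow then shows
    that the common element is a [J]-multiple of itself. *)
Lemma two_arrows_direct s t : x * s = y * t -> x * s = 0.
Proof.
have [ff _ _] := pf; have [gg _ _] := pg.
move=> xsyt; apply: contrapT => xs0.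
have [||h ph xsh] := @prim_split (fun u => u = 0) _ _ _ xs0; first by [].
  by move=> u v -> ->; rewrite addr0.
have [hh _ _] := ph; apply: xsh.
have xsE : x * s * h = x * (f * s * h) by rewrite !mulrA xf.
have ytE : x * s * h = y * (g * t * h) by rewrite xsyt !mulrA yg.
have [||[r sr]|[r tr]] := left_serial_comparable LS (f := h) (a := f * s * h) (b := g * t * h) ph.
- by rewrite -mulrA hh.
- by rewrite -mulrA hh.
- have [|n nJ nE] := crossx (v := r * g); first by rewrite -mulrA gg.
  apply: (radical_fix_l nJ); rewrite {2}ytE mulrA -nE xsE sr -!mulrA (mulrA g g) gg.
  by rewrite !mulrA.
- have [|n nJ nE] := crossy (v := r * f); first by rewrite -mulrA ff.
  apply: (radical_fix_l nJ); rewrite {2}xsE mulrA -nE ytE tr -!mulrA (mulrA f f) ff.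
  by rewrite !mulrA.
Qed.

Section IntoSource.
Variables (z : A) (zJ : z \in J).
Hypothesis gen : forall b, b \in J -> b * e = b -> exists r, b = r * z.

(** [J^3 h] lies in [J z u]: the last factor is a multiple of [u], and [J^2 e] lies in [J z]. So
    [z u] in [J^3] would be a [J]-multiple of itself. *)
Lemma two_step_nonzero h u : prim_idem h -> u \in J -> e * u = u -> u * h = u ->
  u \notin (J ^+ 2)%VS -> z * u <> 0 -> z * u \notin (J ^+ 3)%VS.
Proof.
move=> ph uJ eu uh nu zu0; apply/negP => zuJ; apply: zu0.
have [ee _ _] := pe.
suff main w : w \in (J ^+ 3)%VS -> exists2 n, n \in J & w * h = n * (z * u).
  by have [n nJ nE] := main _ zuJ; apply: (radical_fix_l nJ); rewrite -nE -!mulrA uh.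
rewrite (expvSr _ 2); elim/prodv_closed: w / => [|a b [n nJ nE] [n' nJ' nE']|a b aJ bJ].
- by exists 0; rewrite ?mem0v // !mul0r.
- by exists (n + n'); rewrite ?memvD // !mulrDl nE nE'.
have [||r br] := arrow_generates ph uJ uh nu (b := b * h).
- by rewrite radical_mulr.
- by rewrite -mulrA; have [-> _ _] := ph.
suff [n nJ nE] : exists2 n, n \in J & a * r * e = n * z.
  by exists n => //; rewrite -mulrA br -[in LHS]eu !mulrA nE.
have : a * r \in (J ^+ 2)%VS by exact: radicalX_mulr.
rewrite expv2; elim/prodv_closed: (a * r) / => [|c d [n nJ nE] [n' nJ' nE']|c d cJ dJ].
- by exists 0; rewrite ?mem0v // !mul0r.
- by exists (n + n'); rewrite ?memvD // !mulrDl nE nE'.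
have [||q dq] := gen (b := d * e); rewrite ?radical_mulr //.
  by rewrite -mulrA ee.
by exists (c * q); rewrite ?radical_mulr // -!mulrA dq.
Qed.

(* Here z is a loop at e, and one of the two arrows, say x, is z up to
   isomorphism: the three socle elements are z y, z x (which is z^2) and y. *)
Lemma two_arrows_loop : no_three_socle -> forall v, v \notin J -> f * v * e = v ->
  e * z = z -> z * x <> 0 -> z * y <> 0 -> False.
Proof.
move=> ND v nv fve ez zx0 zy0.
have [ee _ _] := pe; have [ff _ _] := pf; have [gg _ _] := pg.
have nzx := two_step_nonzero pf xJ ex xf nx zx0.
have nzy := two_step_nonzero pg yJ ey yg ny0 zy0.
have fv : f * v = v by rewrite -fve !mulrA ff.
have ve : v * e = v by rewrite -fve -!mulrA ee.
have [t vt] := right_inv pf fv nv; have [t' t'v] := left_inv pe ve nv.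
(* Otherwise [y] factors through [y (g r e t' f)], which crosses over to a [J]-multiple of [x], and
   [y] falls into [J^2]. *)
have geJ r : g * r * e \in J.
  apply/negPn/negP => nJ.
  have [|p pE] := right_inv pg _ nJ; first by rewrite !mulrA gg.
  have [|n nJ' nE] := crossy (v := g * r * e * t' * f); first by rewrite -!mulrA ff.
  case/negP: ny0; rewrite -yg -pE mulrA.
  have -> : y * (g * r * e) = y * (g * r * e * t' * f) * v by rewrite -!mulrA fv t'v ee.
  by rewrite nE -!mulrA (mulrA n) radicalX_mulr // expv2 memv_mul.
(* [g r e] lies in [J e], generated by [z]; peeling off [z] repeatedly puts it in every power of
   [J]. *)
have ge0' r : g * r * e = 0.
  apply: radicalX_eq0 => n; elim: n r => [|n IHn] r; first exact: geJ.
  have [|q qz] := gen (geJ r); first by rewrite -mulrA ee.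
  have -> : g * r * e = g * q * e * z by rewrite -(mulrA _ e) ez -(mulrA g q) -qz !mulrA gg.
  by rewrite expvSr memv_mul.
(* [z y] and [z x] are products of two arrows and [y] is one arrow, whence the bounds [J^3] and
   [J^2]. *)
apply: (ND e (z * y) (z * x) y 2 1) => //; rewrite ?mulrA ?ez //.
  by move=> n nJ; split; rewrite ?(expvSl _ 2) expv2 !memv_mul.
split=> p q.
- apply/negP => h; case/negP: nzy.
  have [|n nJ nE] := crossx (v := p * g); first by rewrite -mulrA gg.
  have {h}h : z * y - y * (g * q * g) \in (J ^+ 3)%VS.
    have -> : z * y - y * (g * q * g) =
        (z * y - z * (x * (p * g)) - y * (q * g)) + z * (x * (p * g)).
      by rewrite [RHS]addrAC subrK !mulrA yg.
    rewrite memvD //; last by rewrite nE expvSl expv2 !memv_mul.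
    by have := radicalX_mulr g h; rewrite mulrBl mulrDl opprD addrA -!mulrA yg.
  (* A nonzero scalar part of [g q g] would put [y] in [J^2]; an element of [J g] is a multiple of
     [y] and passes through [g A e = 0]. *)
  suff gqg : g * q * g = 0 by rewrite gqg mulr0 subr0 in h.
  have gqgJ : g * q * g \in J.
    have [||c cJ] := scalar_mod_radical (a := g * q * g) pg; rewrite ?mulrA ?gg //.
      by rewrite -mulrA gg.
    have [c0|c0] := eqVneq c 0; first by rewrite c0 scale0r subr0 in cJ.
    case/negP: ny0; rewrite -[y](scalerK c0) memvZ //.
    have -> : c *: y = z * y - (z * y - y * (g * q * g)) - y * (g * q * g - c *: g).
      by rewrite mulrBr -scalerAr yg subKr subKr.
    apply: memvB; last by rewrite expv2 memv_mul.
    apply: memvB; first by rewrite expv2 memv_mul.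
    exact: (subvP (radicalXS (leqnSn 1))).
  have [||r rE] := arrow_generates pg yJ yg ny0 (b := g * q * g) => //.
    by rewrite -mulrA gg.
  have -> : g * q * g = g * r * e * y by rewrite -!mulrA ey -rE !mulrA gg.
  by rewrite ge0' mul0r.
- apply/negP => h; case/negP: nzx.
  have [|n nJ nE] := crossy (v := p * f); first by rewrite -mulrA ff.
  have qf0 : g * q * f = 0.
    have := ge0' (q * v); rewrite -!mulrA ve => gqv.
    by rewrite -vt (mulrA q) mulrA gqv mul0r.
  have := radicalX_mulr f h; rewrite mulrBl mulrDl -!mulrA xf.
  rewrite -{2}yg -(mulrA y) (mulrA g) qf0 mulr0 addr0 nE => {}h.
  rewrite -[X in X \in _](subrK (z * (n * x))) memvD //.
  by rewrite expvSl expv2 !memv_mul.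
- apply/negP => h; case/negP: ny0; rewrite -[y](subrK (z * y * p + z * x * q)) memvD //.
  by rewrite memvD // radicalX_mulr // expv2 memv_mul.
Qed.
End IntoSource.
End TwoArrows.

(** Let [z] be the arrow into [e]; the case of [z x] and [z y] both nonzero must be excluded. If [z]
    starts at another vertex this is [no_branching]; otherwise [z] becomes a loop, equal to one of
    the two arrows up to a unit and other terms, and [two_arrows_loop] applies. *)
Lemma two_arrows_unramified e f g x y : no_three_socle -> no_branching ->
  prim_idem e -> prim_idem f -> prim_idem g -> x \in J -> y \in J ->
  e * x = x -> e * y = y -> x * f = x -> y * g = y ->
  x \notin (J ^+ 2)%VS -> (forall s, y - x * s \notin (J ^+ 2)%VS) ->
  (forall b, b \in J -> e * b = b -> exists s t, b = x * s + y * t) ->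
  (forall j, j \in J -> j * x = 0) \/ (forall j, j \in J -> j * y = 0).
Proof.
move=> ND NB pe pf pg xJ yJ ex ey xf yg nx ny span.
have [ee _ _] := pe; have [ff _ _] := pf; have [gg _ _] := pg.
have nxy := not_factor_sym pf pg xf yg xJ yJ nx ny.
have ny0 : y \notin (J ^+ 2)%VS by have := ny 0; rewrite mulr0 subr0.
have [e0 [z [pe0 zJ e0z ze gen]]] := LS pe; have [ee0 _ _] := pe0.
have kill u : e * u = u -> z * u = 0 -> forall j, j \in J -> j * u = 0.
  move=> eu zu j jJ; have [||r jr] := gen (j * e); rewrite ?radical_mulr //.
    by rewrite -mulrA ee.
  by rewrite -eu mulrA jr -mulrA zu mulr0.
have [zx0|zx0] := pselect (z * x = 0); first by left; apply: kill.
have [zy0|zy0] := pselect (z * y = 0); first by right; apply: kill.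
exfalso.
have [e0J|] := pselect (forall r, e0 * r * e \in J).
  apply: (NB e0 e z x y) => //.
    by move=> r; apply: gen => //; rewrite -mulrA ee.
  have nzx := two_step_nonzero pe gen pf xJ ex xf nx zx0.
  have nzy := two_step_nonzero pe gen pg yJ ey yg ny0 zy0.
  split=> p; apply/negP => h.
    have [|n nJ nE] := arrow_cross pe pf ex ey xf yg xJ yJ nx nxy (v := p * f).
      by rewrite -mulrA ff.
    case/negP: nzx; have := radicalX_mulr f h; rewrite mulrBl -!mulrA xf nE => {}h.
    by rewrite -[X in X \in _](subrK (z * (n * x))) memvD // expvSl expv2 !memv_mul.
  have [|n nJ nE] := arrow_cross pe pg ey ex yg xf yJ xJ ny0 ny (v := p * g).
    by rewrite -mulrA gg.
  case/negP: nzy; have := radicalX_mulr g h; rewrite mulrBl -!mulrA yg nE => {}h.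
  by rewrite -[X in X \in _](subrK (z * (n * y))) memvD // expvSl expv2 !memv_mul.
move=> h; have [r nr] : exists r, e0 * r * e \notin J.
  by apply: contra_notP h => h r; apply/negPn/negP => nr; apply: h; exists r.
have [|u ur] := right_inv pe0 _ nr; first by rewrite !mulrA ee0.
(* [z] transported along the isomorphism of [e0] with [e], hence a loop at [e]. *)
pose w := e * u * e0 * z.
have zw : z = e0 * r * w by rewrite /w !mulrA ur ee0 e0z.
have ew : e * w = w by rewrite /w !mulrA ee.
have we : w * e = w by rewrite /w -!mulrA ze.
have wJ : w \in J by rewrite radical_mull.
have wgen b : b \in J -> b * e = b -> exists q, b = q * w.
  by move=> bJ be; have [q ->] := gen b bJ be; exists (q * e0 * r); rewrite -mulrA -mulrA (mulrA e0) -zw.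
have wx0 : w * x <> 0 by move=> wx0; apply: zx0; rewrite zw -mulrA wx0 mulr0.
have wy0 : w * y <> 0 by move=> wy0; apply: zy0; rewrite zw -mulrA wy0 mulr0.
have nw : w \notin (J ^+ 2)%VS.
  apply/negP => w2; apply: wx0.
  suff main c : c \in (J ^+ 2)%VS -> exists2 n, n \in J & c * e = n * w.
    have [n nJ nE] := main w w2; have -> : w = 0 by apply: (radical_fix_l nJ); rewrite -nE we.
    by rewrite mul0r.
  rewrite expv2; elim/prodv_closed: c / => [|a b [n nJ nE] [n' nJ' nE']|a b aJ bJ].
  - by exists 0; rewrite ?mem0v // !mul0r.
  - by exists (n + n'); rewrite ?memvD // !mulrDl nE nE'.
  have [||q qE] := wgen (b * e); rewrite ?radical_mulr // -?mulrA ?ee //.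
  by exists (a * q); rewrite ?radical_mulr // -!mulrA qE.
(* Since [w] is outside [J^2], its coefficient on [x] or on [y] is outside [J]. *)
have [s [t wE]] := span w wJ ew.
have [sJ|ns] := boolP (f * s * e \in J); last first.
  apply: (two_arrows_loop pe pf pg xJ yJ ex ey xf yg nx ny wJ wgen ND ns) => //.
  by rewrite !mulrA ff -mulrA ee.
have [tJ|nt] := boolP (g * t * e \in J); last first.
  apply: (two_arrows_loop pe pg pf yJ xJ ey ex yg xf ny0 nxy wJ wgen ND nt) => //.
  by rewrite !mulrA gg -mulrA ee.
case/negP: nw; rewrite -we wE -xf -yg mulrDl -!mulrA !(mulrA f) !(mulrA g).
by rewrite expv2 memvD ?memv_mul.
Qed.

(** Arrows independent modulo [J^2] are extracted one at a time; a third contradicts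
    [no_three_socle] with both bounds [J^2]. Of two arrows, one killed by [J] is put second. *)
Theorem arms_ex : no_three_socle -> no_branching ->
  forall e, prim_idem e -> exists x y, arms e x y.
Proof.
move=> ND NB e pe; have [ee _ _] := pe.
have arrow (X : A -> Prop) : X 0 -> (forall u v, X u -> X v -> X (u + v)) ->
    ~ (forall b, b \in J -> e * b = b -> X b) ->
    exists f x, [/\ prim_idem f, x \in J, e * x = x, x * f = x & ~ X x].
  move=> X0 XD h; have [b [bJ eb nXb]] : exists b, [/\ b \in J, e * b = b & ~ X b].
    by apply: contra_notP h => h b bJ eb; apply: contrapT => nX; apply: h; exists b.
  have [f pf nX] := prim_split X0 XD nXb; have [ff _ _] := pf.
  by exists f, (b * f); split; rewrite ?radical_mulr // ?mulrA ?eb // -mulrA ff.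
have [none|h1] := pselect (forall b, b \in J -> e * b = b -> b \in (J ^+ 2)%VS).
  have gen0 : forall b, b \in J -> e * b = b -> exists s t, b = 0 * s + 0 * t.
    apply: nakayama_right; rewrite ?mulr0 // => b bJ eb; exists 0, 0.
    by rewrite !mul0r addr0 subr0; apply: none.
  exists 0, 0; split; rewrite ?mem0v ?mulr0 //; try by exists e; rewrite ?mul0r.
  by split=> [s t|j _]; rewrite ?mulr0 ?mul0r.
have [||f [x [pf xJ ex xf /negP nx]]] := arrow _ _ _ h1; first exact: mem0v.
  by move=> u v; apply: memvD.
pose X1 b := exists s, b - x * s \in (J ^+ 2)%VS.
have [one|h2] := pselect (forall b, b \in J -> e * b = b -> X1 b).
  have gen1 : forall b, b \in J -> e * b = b -> exists s t, b = x * s + 0 * t.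
    apply: nakayama_right; rewrite ?mulr0 // => b bJ eb.
    by have [s hs] := one b bJ eb; exists s, 0; rewrite mul0r addr0.
  exists x, 0; split; rewrite ?mem0v ?mulr0 //; [by exists f|by exists f; rewrite ?mul0r|].
  by split=> [s t|j _]; rewrite ?mulr0 ?mul0r.
have [||g [y [pg yJ ey yg nX1]]] := arrow _ _ _ h2.
- by exists 0; rewrite mulr0 subr0 mem0v.
- by move=> u v [s hs] [t ht]; exists (s + t); rewrite mulrDr opprD addrACA memvD.
have ny s : y - x * s \notin (J ^+ 2)%VS by apply/negP => h; apply: nX1; exists s.
have nxy := not_factor_sym pf pg xf yg xJ yJ nx ny.
have ny0 : y \notin (J ^+ 2)%VS by have := ny 0; rewrite mulr0 subr0.
pose X2 b := exists s t, b - (x * s + y * t) \in (J ^+ 2)%VS.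
have [two|h3] := pselect (forall b, b \in J -> e * b = b -> X2 b).
  have gen2 := nakayama_right ee ex ey two.
  have [jx|jy] := two_arrows_unramified ND NB pe pf pg xJ yJ ex ey xf yg nx ny gen2.
    exists y, x; split=> //; [by exists g|by exists f| |].
      by move=> b bJ eb; have [s [t ->]] := gen2 b bJ eb; exists t, s; rewrite addrC.
    split=> // s t; exact: (two_arrows_direct pe pg pf yJ xJ ey ex yg xf ny0 nxy).
  exists x, y; split=> //; [by exists f|by exists g|].
  split=> // s t; exact: (two_arrows_direct pe pf pg xJ yJ ex ey xf yg nx ny).
have [||h [u [ph uJ eu uh nX2]]] := arrow _ _ _ h3.
- by exists 0, 0; rewrite !mulr0 addr0 subr0 mem0v.
- move=> u v [s [t h]] [s' [t' h']]; exists (s + s'), (t + t').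
  by rewrite !mulrDr (addrACA (x * s)) opprD addrACA memvD.
exfalso; have [hh _ _] := ph.
apply: (ND e x y u 1 1) => //; first by move=> n nJ; rewrite expv2 !memv_mul.
(* A term [u q] is negligible or recovers [u], so a relation among the three arrows relates [x] and
   [y] alone or expresses [u] by them. *)
have uq q : u * q \in (J ^+ 2)%VS \/ exists t, u * q * t = u.
  have [hq|hq] := boolP (h * q \in J); first by left; rewrite -uh -mulrA expv2 memv_mul.
  have [|t tE] := right_inv ph _ hq; first by rewrite mulrA hh.
  by right; exists t; rewrite -[in LHS]uh -(mulrA u) -mulrA tE uh.
split=> p q; apply/negP => H; last by apply: nX2; exists p, q.
- have [uJ2|[t tE]] := uq q.
    case/negP: (nxy p); rewrite -[X in X \in _](subrK (u * q)) memvD //.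
    by rewrite -addrA -opprD.
  apply: nX2; exists t, (- (p * t)).
  rewrite -memvN opprB (_ : _ - u = (x - (y * p + u * q)) * t) ?radicalX_mulr //.
  by rewrite mulrBl mulrDl tE opprD addrA mulrN mulrA.
- have [uJ2|[t tE]] := uq q.
    case/negP: (ny p); rewrite -[X in X \in _](subrK (u * q)) memvD //.
    by rewrite -addrA -opprD.
  apply: nX2; exists (- (p * t)), t.
  rewrite -memvN opprB (_ : _ - u = (y - (x * p + u * q)) * t) ?radicalX_mulr //.
  by rewrite mulrBl mulrDl tE opprD addrA mulrN mulrA (addrC (y * t)).
Qed.

End Arms.
End LeftSerial.

(** * Right modules written with a right action *)

Definition ract (A : nzRingType) (M : lmodType A^c) (x : M) (a : A) : M := (a : A^c) *: x.
Notation "x |> a" := (ract x a) (at level 40, left associativity) : ring_scope.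

Section RightAction.
Variables (A : nzRingType) (M : lmodType A^c).
Implicit Types (x y : M) (a b : A).

Lemma ractM x a b : x |> (a * b) = x |> a |> b.
Proof. by rewrite /ract scalerA. Qed.
Lemma ract1 x : x |> 1 = x. Proof. exact: scale1r. Qed.
Lemma ract0 x : x |> 0 = 0. Proof. exact: scale0r. Qed.
Lemma ract0l a : (0 : M) |> a = 0. Proof. exact: scaler0. Qed.
Lemma ractDr x a b : x |> (a + b) = x |> a + x |> b. Proof. exact: scalerDl. Qed.
Lemma ractDl x y a : (x + y) |> a = x |> a + y |> a. Proof. exact: scalerDr. Qed.
Lemma ractNr x a : x |> (- a) = - (x |> a). Proof. exact: scaleNr. Qed.
Lemma ractNl x a : (- x) |> a = - (x |> a). Proof. exact: scalerN. Qed.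
Lemma ractBr x a b : x |> (a - b) = x |> a - x |> b. Proof. by rewrite ractDr ractNr. Qed.
Lemma ractBl x y a : (x - y) |> a = x |> a - y |> a. Proof. by rewrite ractDl ractNl. Qed.

Lemma ract_sumr x (I : Type) (r : seq I) (P : pred I) (F : I -> A) :
  x |> (\sum_(i <- r | P i) F i) = \sum_(i <- r | P i) x |> F i.
Proof. exact: scaler_suml. Qed.

Lemma ract_suml a (I : Type) (r : seq I) (P : pred I) (F : I -> M) :
  (\sum_(i <- r | P i) F i) |> a = \sum_(i <- r | P i) F i |> a.
Proof. exact: scaler_sumr. Qed.
End RightAction.

(** * Extending isomorphisms between simple submodules of local modules *)

Section Extension.
Variables (k : closedFieldType) (A : falgType k).
Local Notation J := (radical A).
Hypotheses (LS : left_serial A)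
  (AR : forall e : A, prim_idem e -> exists x y, arms e x y).
Implicit Types (a b e f r s t u v : A).

Definition uniserial (m : A) := forall s t,
  (exists r, m * s = m * t * r) \/ (exists r, m * t = m * s * r).

(** [m J = m x A], because [m y] is in [J y = 0]; the argument repeats with [m x], one step deeper
    in the radical. *)
Lemma radical_uniserial e m : prim_idem e -> m \in J -> m * e = m -> uniserial m.
Proof.
move=> pe mJ me; have [N JN] := radical_nilpotent A.
suff main d n e' m' : (N <= n + d)%N -> prim_idem e' -> m' \in (J ^+ n.+1)%VS ->
  m' * e' = m' -> uniserial m'.
  by apply: (main N 0%N e).
elim: d n e' m' => [|d IHd] n {pe me mJ m}e' m Nn pe mJ me s t.
  have : m \in (J ^+ N.+1)%VS by apply: (subvP (radicalXS A _)) mJ; rewrite addn0 in Nn.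
  by rewrite expvSl JN prodv0 memv0 => /eqP ->; left; exists 0; rewrite !mul0r.
have [ee _ _] := pe.
have unit p q : e' * p \notin J -> exists r, m * q = m * p * r.
  move=> np; have [|r pr] := right_inv pe _ np; first by rewrite mulrA ee.
  by exists (r * q); rewrite -[in LHS]me -pr !mulrA me.
have [sJ|/(unit s t)] := boolP (e' * s \in J); last by right.
have [tJ|/(unit t s)] := boolP (e' * t \in J); last by left.
have [x [y [[xJ yJ ex ey] [f pf xf] _ span [_ Jy]]]] := AR pe.
have mJ1 : m \in J by rewrite -[J]expv1 (subvP (radicalXS A (leq0n n))).
have step p : e' * p \in J -> exists p', m * p = m * x * p'.
  move=> pJ; have [|p' [q pE]] := span _ pJ; first by rewrite mulrA ee.
  by exists p'; rewrite -[in LHS]me -mulrA pE mulrDr !mulrA Jy // mul0r addr0.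
have [s' ->] := step s sJ; have [t' ->] := step t tJ.
apply: (IHd n.+1 f) => //; first by rewrite addSnnS.
  by rewrite expvSr memv_mul.
by rewrite -mulrA xf.
Qed.

Lemma arms_uniserial e x y : arms e x y -> uniserial x /\ uniserial y.
Proof.
move=> [[xJ yJ _ _] [f pf xf] [g pg yg] _ _].
by split; [apply: radical_uniserial xf|apply: radical_uniserial yg].
Qed.

(** The two elements are comparable in [A h]. A relation [x s = u y t] is impossible: [e u e] acts
    on [y] by a scalar since [J y = 0], and [x A] meets [y A] in 0. *)
Lemma arms_factor e h x y s t : prim_idem e -> prim_idem h -> arms e x y ->
  s * h = s -> t * h = t -> x * s <> 0 ->
  exists2 u, [/\ u \in J, e * u = u & u * e = u] & y * t = u * (x * s).
Proof.
move=> pe ph [[xJ yJ ex ey] _ _ _ [dir Jy]] sh th xs0; have [ee _ _] := pe.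
have bad u : x * s = u * (y * t) -> False.
  move=> xsE; have [||c cJ] := scalar_mod_radical (a := e * u * e) pe.
  - by rewrite !mulrA ee.
  - by rewrite -mulrA ee.
  apply: xs0; apply: (dir s (c *: t)).
  have : (e * u * e - c *: e) * y = 0 by apply: Jy.
  rewrite mulrBl -scalerAl ey => /subr0_eq eu.
  rewrite -scalerAr scalerAl -eu; have -> : x * s = e * (u * (e * y * t)).
    by rewrite ey -xsE mulrA ex.
  by rewrite !mulrA.
have [||[u /bad[]]|[u ytE]] := left_serial_comparable LS (f := h) (a := x * s) (b := y * t) ph.
- by rewrite -mulrA sh.
- by rewrite -mulrA th.
have ytE' : y * t = e * u * e * (x * s) by rewrite -!mulrA (mulrA e x) ex -ytE mulrA ey.
exists (e * u * e) => //; split; rewrite ?mulrA ?ee -?mulrA ?ee //.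
apply/negPn/negP => nJ; have [|v vE] := left_inv pe _ nJ; first by rewrite -!mulrA ee.
by apply: (bad v); rewrite ytE' -(mulrA e u e) mulrA vE mulrA ex.
Qed.

Section Module.
Variable M : lmodType A^c.
Implicit Types (z : M).

Lemma ractZ z (c : k) a : z |> (c *: a) = z |> a |> c%:A.
Proof. by rewrite -ractM -scalerAr mulr1. Qed.

Lemma ract_split z : z <> 0 -> exists2 f, prim_idem f & z |> f <> 0.
Proof.
move=> z0; have [s [ps s1]] := prim_decomposition A.
apply: contrapT => h; apply: z0; rewrite -[z]ract1 -s1 ract_sumr big_seq.
apply: big1 => f fs; apply: contrapT => zf; apply: h; exists f => //; exact: ps.
Qed.

(* That is, z1 a |-> z2 r a is a well-defined homomorphism z1 A -> z2 A fixing z. *)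
Definition extends z z1 z2 :=
  exists r, forall a b, z1 |> a = z |> b -> z2 |> (r * a) = z |> b.

Lemma extends_genl z z1 z1' z2 v : z1 = z1' |> v -> extends z z1' z2 -> extends z z1 z2.
Proof.
move=> z1E [r h]; exists (r * v) => a b; rewrite z1E -ractM => /h.
by rewrite mulrA.
Qed.

Lemma extends_genr z z1 z2 z2' u : z2' = z2 |> u -> extends z z1 z2' -> extends z z1 z2.
Proof. by move=> -> [r h]; exists (u * r) => a b /h; rewrite -ractM mulrA. Qed.

Definition split_gen (x y : A) z := forall s t, z |> (x * s) = z |> (y * t) -> z |> (x * s) = 0.

(** If [z1 x s = z1 y t] is nonzero, then, after cutting by [h], [y t = u x s] with [u] in [J], and
    the equivalent generator [z1 (e - u)] kills [x s]. The annihilator of the [x] arm grows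
    strictly, which ends the process. *)
Lemma split_gen_ex e x y z1 : prim_idem e -> arms e x y -> z1 |> e = z1 ->
  exists z2, [/\ z2 |> e = z2, exists u, z2 = z1 |> u, exists v, z1 = z2 |> v & split_gen x y z2].
Proof.
move=> pe ar; have [ee _ _] := pe; have [ux _] := arms_uniserial ar.
have [[xJ yJ ex ey] _ _ _ [dir Jy]] := ar.
have annP z : exists I : {vspace A}, forall a, a \in I <-> z |> (x * a) = 0.
  apply: vspace_of_pred => [|c a b a0 b0]; first by rewrite mulr0 ract0.
  by rewrite mulrDr ractDr b0 addr0 -scalerAr ractZ a0 ract0l.
pose I z := projT1 (cid (annP z)).
have IP z a : a \in I z <-> z |> (x * a) = 0 by exact: (projT2 (cid (annP z))).
have [d] := ubnP (\dim {:A} - \dim (I z1)); elim: d z1 => // d IHd z1 ltd z1e.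
have [sp|nsp] := pselect (split_gen x y z1).
  by exists z1; split=> //; exists 1; rewrite ract1.
have [s [t [st st0]]] : exists s t, z1 |> (x * s) = z1 |> (y * t) /\ z1 |> (x * s) <> 0.
  apply: contra_notP nsp => h s t st; apply: contrapT => st0; apply: h; by exists s, t.
have [h ph sth] := ract_split st0; have [hh _ _] := ph.
have xsh : x * (s * h) <> 0 by move=> xsh; apply: sth; rewrite -ractM -mulrA xsh ract0.
have [||u [uJ eu ue] ytE] := arms_factor pe ph ar (s := s * h) (t := t * h) _ _ xsh.
- by rewrite -mulrA hh.
- by rewrite -mulrA hh.
have nu : e - u \notin J.
  by apply: contra (prim_notin pe) => euJ; rewrite -(subrK u e) memvD.
have [|v vE] := right_inv pe _ nu; first by rewrite mulrBr ee eu.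
have z2x a : z1 |> (e - u) |> a = z1 |> (e * a) - z1 |> (u * a).
  by rewrite -ractM mulrBl ractBr.
have z2s : z1 |> (e - u) |> (x * (s * h)) = 0.
  by rewrite z2x mulrA ex -ytE (mulrA x) (mulrA y) !(ractM _ _ h) st subrr.
have [||z2 [z2e [u' uE] [v' vE'] sp]] := IHd (z1 |> (e - u)); last 1 first.
- exists z2; split=> //.
    by exists ((e - u) * u'); rewrite ractM.
  by exists (v' * v); rewrite ractM -vE' -ractM vE.
- have sub : (I z1 <= I (z1 |> (e - u)))%VS.
    apply/subvP => a /IP a0; apply/IP; have [[r xr]|[r xr]] := ux a (s * h).
      by rewrite xr ractM z2s ract0l.
    by case: sth; rewrite -ractM -mulrA xr ractM a0 ract0l.
  have lt : (\dim (I z1) < \dim (I (z1 |> (e - u))))%N.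
    rewrite ltnNge; apply/negP => le; apply: sth; rewrite -ractM -mulrA; apply/IP.
    have /eqP -> : I z1 == I (z1 |> (e - u)) by rewrite eqEdim sub.
    exact/IP.
  rewrite -ltnS (leq_trans _ ltd) // ltnS ltn_sub2l //.
  by rewrite (leq_trans lt) // dimvS ?subvf.
- by rewrite -ractM mulrBl ee ue.
Qed.

Section Socle.
Variables (z : M) (h : A).
Hypotheses (ph : prim_idem h) (z0 : z <> 0) (zh : z |> h = z)
  (zJ : forall j, j \in J -> z |> j = 0).

Let hh : h * h = h. Proof. by have [] := ph. Qed.

Lemma socle_ract_radical a : h * a \in J -> z |> a = 0.
Proof. by move=> aJ; rewrite -[z in LHS]zh -ractM zJ. Qed.

Lemma socle_ract_inv a : z |> a <> 0 -> exists r, z |> a |> r = z.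
Proof.
move=> za0; have [/socle_ract_radical //|na] := boolP (h * a \in J).
have [|r rE] := right_inv ph _ na; first by rewrite mulrA hh.
by exists r; rewrite -ractM -[z in LHS]zh -ractM mulrA rE.
Qed.

Lemma socle_ract_scalar r : h * r * h = r -> exists2 c : k, z |> r = z |> (c *: 1) &
  r - c *: h \in J.
Proof.
move=> hr; have [||c cJ] := scalar_mod_radical (a := r) ph.
- by rewrite -hr !mulrA hh.
- by rewrite -hr -mulrA hh.
exists c => //; have := zJ cJ; rewrite ractBr => /subr0_eq ->.
by rewrite -[in RHS]zh -ractM -scalerAr mulr1.
Qed.

Lemma ract_scalerK z1 z2 (c : k) : z2 |> (c *: 1) = z1 -> c <> 0 -> z2 = z1 |> (c^-1 *: 1).
Proof.
by move=> <- /eqP c0; rewrite -ractM -scalerAl mul1r scalerA divff // scale1r ract1.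
Qed.

Definition arm_element (x y : A) a := (exists s, a = x * s) \/ (exists t, a = y * t).

(** If [z] has components on both arms, [y t = w x s] with [w] in [J]. The generator [z2 (e + w)]
    carries all of [z] on its [x] arm and has the same [y] arm, as [J y = 0]. *)
Lemma split_gen_socle e x y z1 a : prim_idem e -> arms e x y -> z1 |> e = z1 ->
  a \in J -> e * a = a -> a * h = a -> z1 |> a = z ->
  exists z2 b, [/\ z2 |> e = z2 /\ split_gen x y z2, exists u, z2 = z1 |> u, exists v, z1 = z2 |> v,
    [/\ b \in J, e * b = b & b * h = b] & z2 |> b = z /\ arm_element x y b].
Proof.
move=> pe ar z1e aJ ea ah z1a; have [ee _ _] := pe; have [ux _] := arms_uniserial ar.
have [z2 [z2e [u uE] [v vE] sp]] := split_gen_ex pe ar z1e.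
have [[xJ yJ ex ey] _ _ span [_ Jy]] := ar.
have [||s [t stE]] := span (e * v * a); first by rewrite radical_mull.
  by rewrite !mulrA ee.
have xsJ q : [/\ x * (q * h) \in J, e * (x * (q * h)) = x * (q * h) & x * (q * h) * h = x * (q * h)].
  by rewrite radical_mulr // mulrA ex -!mulrA hh.
have ytJ q : [/\ y * (q * h) \in J, e * (y * (q * h)) = y * (q * h) & y * (q * h) * h = y * (q * h)].
  by rewrite radical_mulr // mulrA ey -!mulrA hh.
have zE : z2 |> (x * (s * h)) + z2 |> (y * (t * h)) = z.
  rewrite -ractDr !mulrA -mulrDl -stE -!mulrA ah ractM z2e.
  by rewrite ractM -vE z1a.
have [xs0|xs0] := pselect (z2 |> (x * (s * h)) = 0).
  exists z2, (y * (t * h)); rewrite xs0 add0r in zE; split=> //; [by exists u|by exists v|].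
  by split=> //; right; exists (t * h).
have [yt0|yt0] := pselect (z2 |> (y * (t * h)) = 0).
  exists z2, (x * (s * h)); rewrite yt0 addr0 in zE; split=> //; [by exists u|by exists v|].
  by split=> //; left; exists (s * h).
have xs1 : x * (s * h) <> 0 by move=> xs1; apply: xs0; rewrite xs1 ract0.
have [||w [wJ ew we] ytE] := arms_factor pe ph ar (s := s * h) (t := t * h) _ _ xs1.
- by rewrite -mulrA hh.
- by rewrite -mulrA hh.
have nw : e + w \notin J.
  by apply: contra (prim_notin pe) => ewJ; rewrite -(addrK w e) memvB.
have [|v' vE'] := right_inv pe _ nw; first by rewrite mulrDr ee ew.
have z3y p : z2 |> (e + w) |> (y * p) = z2 |> (y * p).
  by rewrite -ractM mulrDl !mulrA ey Jy // mul0r addr0.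
have z3x : z2 |> (e + w) |> (x * (s * h)) = z.
  by rewrite -ractM mulrDl (mulrA e) ex -ytE ractDr.
have zny q : z <> z2 |> (y * q).
  move=> zq; apply: xs0; apply: (sp _ (q - t * h)).
  by rewrite mulrBr ractBr -zq -zE addrK.
exists (z2 |> (e + w)), (x * (s * h)); split=> //.
- split; first by rewrite -ractM mulrDl ee we.
  (* A nonzero common element of the new arms would generate [z] inside the [y] arm, against
     [zny]. *)
  move=> p q pq; apply: contrapT => p0; rewrite z3y in pq.
  have [[r xr]|[r xr]] := ux p (s * h).
    have zr : z |> r = z2 |> (y * q) by rewrite -pq xr ractM z3x.
    have [|r' zr'] := @socle_ract_inv r; first by rewrite zr -pq.
    by apply: (zny (q * r')); rewrite -zr' zr mulrA [RHS]ractM.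
  by apply: (zny (q * r)); rewrite -z3x xr ractM pq mulrA [RHS]ractM.
- by exists (u * (e + w)); rewrite ractM -uE.
- by exists (v' * v); rewrite ractM -(ractM z2) vE' z2e.
- by split=> //; left; exists (s * h).
Qed.

(** The map is [z1 c |-> z2 u c]. In the radical only the [x1] arm matters, as [u y1 = 0], and its
    elements are comparable with [a], on which the map is known. *)
Lemma extends_radical e1 x1 y1 z1 z2 a u : prim_idem e1 -> arms e1 x1 y1 ->
  z1 |> e1 = z1 -> split_gen x1 y1 z1 -> z1 |> a = z -> arm_element x1 y1 a -> e1 * a = a ->
  u \in J -> u * e1 = u -> z2 |> (u * a) = z -> extends z z1 z2.
Proof.
move=> pe ar z1e sp z1a arma ea uJ ue z2a; have [ee _ _] := pe; have [ux _] := arms_uniserial ar.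
have [[xJ yJ ex ey] _ _ span [_ Jy]] := ar.
exists u => p q pq.
have pq0 : z1 |> (e1 * (p - a * q)) = 0.
  by rewrite ractM z1e ractBr ractM z1a pq subrr.
suff pq1 : z2 |> (u * (e1 * (p - a * q))) = 0.
  move: pq1; rewrite mulrA ue mulrBr ractBr => /subr0_eq ->.
  by rewrite mulrA ractM z2a.
have [cJ|nc] := boolP (e1 * (p - a * q) \in J); last first.
  have [|r rE] := right_inv pe _ nc; first by rewrite mulrA ee.
  have z10 : z1 = 0 by rewrite -z1e -rE ractM pq0 ract0l.
  by case: z0; rewrite -z1a z10 ract0l.
have [|s [t cE]] := span _ cJ; first by rewrite mulrA ee.
have xs0 : z1 |> (x1 * s) = 0.
  apply: (sp s (- t)); apply/eqP; rewrite mulrN ractNr -subr_eq0 opprK -ractDr -cE.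
  by rewrite pq0.
rewrite cE mulrDr (mulrA u y1) Jy // mul0r addr0.
case: arma => [[s' aE]|[t' aE]]; last first.
  by case: z0; rewrite -z2a aE mulrA Jy // mul0r ract0.
have [[r xr]|[r xr]] := ux s s'; last first.
  by case: z0; rewrite -z1a aE xr ractM xs0 ract0l.
by rewrite xr -aE mulrA ractM z2a -z1a -ractM aE -xr.
Qed.

Lemma extends_split e x y z1 z2 a : prim_idem e -> arms e x y ->
  z1 |> e = z1 -> z2 |> e = z2 -> split_gen x y z1 -> z1 |> a = z -> z2 |> a = z ->
  (forall p, z1 |> (x * p) = 0 -> z2 |> (x * p) = 0) ->
  (forall p, z1 |> (y * p) = 0 -> z2 |> (y * p) = 0) -> extends z z1 z2.
Proof.
move=> pe ar z1e z2e sp z1a z2a annx anny; have [ee _ _] := pe.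
have [[xJ yJ ex ey] _ _ span _] := ar.
exists e => p q pq; rewrite -z2a ractM z2e.
apply/subr0_eq; rewrite -ractM -ractBr.
have pq0 : z1 |> (e * (p - a * q)) = 0.
  by rewrite ractM z1e ractBr ractM z1a pq subrr.
rewrite -[z2]z2e -ractM.
have [cJ|nc] := boolP (e * (p - a * q) \in J); last first.
  have [|r rE] := right_inv pe _ nc; first by rewrite mulrA ee.
  have z10 : z1 = 0 by rewrite -z1e -rE ractM pq0 ract0l.
  by case: z0; rewrite -z1a z10 ract0l.
have [|s [t cE]] := span _ cJ; first by rewrite mulrA ee.
have xs0 : z1 |> (x * s) = 0.
  apply: (sp s (- t)); apply/eqP; rewrite mulrN ractNr -subr_eq0 opprK -ractDr -cE.
  by rewrite pq0.
have yt0 : z1 |> (y * t) = 0 by have := pq0; rewrite cE ractDr xs0 add0r.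
by rewrite cE ractDr annx // anny // addr0.
Qed.

Lemma uniserial_ann_total m z1 z2 : uniserial m ->
  (forall p, z1 |> (m * p) = 0 -> z2 |> (m * p) = 0) \/
  (forall p, z2 |> (m * p) = 0 -> z1 |> (m * p) = 0).
Proof.
move=> um; apply: contrapT => /not_orP[N1 N2].
have [p [p1 p2]] : exists p, z1 |> (m * p) = 0 /\ z2 |> (m * p) <> 0.
  by apply: contra_notP N1 => H p p1; apply: contrapT => p2; apply: H; exists p.
have [q [q2 q1]] : exists p, z2 |> (m * p) = 0 /\ z1 |> (m * p) <> 0.
  by apply: contra_notP N2 => H q q2; apply: contrapT => q1; apply: H; exists q.
have [[r E]|[r E]] := um p q.
  by apply: p2; rewrite E ractM q2 ract0l.
by apply: q1; rewrite E ractM p1 ract0l.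
Qed.

(** On the arm of [a] the annihilators agree, because [z1 a r = z r = z2 a r]. On the other arm
    uniseriality makes one contain the other, which decides the direction. *)
Lemma extends_common e x y z1 z2 a : prim_idem e -> arms e x y ->
  z1 |> e = z1 -> z2 |> e = z2 -> split_gen x y z1 -> split_gen x y z2 ->
  z1 |> a = z -> z2 |> a = z -> arm_element x y a -> extends z z1 z2 \/ extends z z2 z1.
Proof.
move=> pe ar z1e z2e sp1 sp2 z1a z2a arma; have [ux uy] := arms_uniserial ar.
have arm_ann m s y1 y2 : uniserial m -> a = m * s -> y1 |> a = z -> y2 |> a = z ->
    forall p, y1 |> (m * p) = 0 -> y2 |> (m * p) = 0.
  move=> um aE y1a y2a p p0; have [[r E]|[r E]] := um p s.
    by rewrite E -aE ractM y2a -y1a -ractM aE -E.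
  by case: z0; rewrite -y1a aE E ractM p0 ract0l.
case: arma => [[s aE]|[t aE]].
  have [ann|ann] := uniserial_ann_total z1 z2 uy; [left|right];
    apply: (extends_split (a := a) pe ar) => //; exact: (arm_ann _ s _ _ ux aE).
have [ann|ann] := uniserial_ann_total z1 z2 ux; [left|right];
  apply: (extends_split (a := a) pe ar) => //; exact: (arm_ann _ t _ _ uy aE).
Qed.

(* If the two socle elements differ by a unit of e A e, they differ by a scalar
   because A is split over the algebraically closed field k. *)
Lemma arm_element_scalar e x y z2 a b u : prim_idem e -> arms e x y ->
  a \in J -> e * a = a -> a * h = a -> arm_element x y a ->
  b \in J -> e * b = b -> b * h = b -> arm_element x y b ->
  e * u = u -> u * e = u -> u \notin J -> b = u * a -> z2 |> b = z ->
  exists2 c : k, c <> 0 & z2 |> (c *: a) = z.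
Proof.
move=> pe ar aJ ea ah arma bJ eb bh armb eu ue nu bE z2b; have [ee _ _] := pe.
have [[xJ yJ ex ey] _ _ span [dir Jy]] := ar; have [ux _] := arms_uniserial ar.
have b0 : b <> 0 by move=> b0; apply: z0; rewrite -z2b b0 ract0.
have a0 : a <> 0 by move=> a0; apply: b0; rewrite bE a0 mulr0.
have [v vu] := left_inv pe ue nu.
have aE : a = e * v * e * b.
  by rewrite -!mulrA eb bE (mulrA v) vu ea.
have yscal w t : e * w * e = w -> exists c : k, w * (y * t) = y * (c *: t).
  move=> ew; have [||c cJ] := scalar_mod_radical (a := w) pe.
  - by rewrite -ew !mulrA ee.
  - by rewrite -ew -mulrA ee.
  have := Jy _ cJ; rewrite mulrBl -scalerAl ey => /subr0_eq wy.
  by exists c; rewrite mulrA wy -scalerAl -scalerAr.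
case: arma => [[s as']|[t at']]; last first.
  have [|c cE] := yscal u t; first by rewrite eu ue.
  have bE' : b = c *: a by rewrite bE at' cE scalerAr.
  exists c; last by rewrite -bE'.
  by move=> c0; apply: b0; rewrite bE' c0 scale0r.
case: armb => [[s' bs']|[t' bt']]; last first.
  have [|c cE] := yscal (e * v * e) t'; first by rewrite !mulrA ee -!mulrA ee.
  by case: a0; rewrite as'; apply: (dir s (c *: t')); rewrite -cE -bt' -aE.
have fin r : h * r * h = r -> r \notin J -> z2 |> a |> r = z \/ z2 |> a = z |> r ->
  exists2 c : k, c <> 0 & z2 |> (c *: a) = z.
  move=> hrh nr cases.
  have main q : h * q * h = q -> q \notin J -> z2 |> a = z |> q ->
      exists2 c : k, c <> 0 & z2 |> (c *: a) = z.
    move=> hq nq z2a; have [c zc cJ] := socle_ract_scalar hq.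
    have c0 : c <> 0 by move=> c0; case/negP: nq; rewrite c0 scale0r subr0 in cJ.
    exists c^-1; first by apply/eqP; rewrite invr_eq0; apply/eqP.
    rewrite -[_ *: a]mulr1 -scalerAl scalerAr ractM z2a zc -ractM -scalerAl mul1r.
    by rewrite scalerA divff ?scale1r ?ract1 //; apply/eqP.
  case: cases => [z2ar|]; last exact: main.
  have rh : r * h = r by rewrite -hrh -mulrA hh.
  have hr : h * r = r by rewrite -hrh !mulrA hh.
  have [q rq] := right_inv ph hr nr.
  apply: (main (h * q * h)); first by rewrite !mulrA hh -mulrA hh.
    apply/negP => qJ; case/negP: (prim_notin ph).
    have -> : h = r * (h * q * h) by rewrite !mulrA rh rq hh.
    by rewrite radical_mull.
  have aq : a * r * (h * q * h) = a.
    by rewrite !mulrA -(mulrA a r h) rh -(mulrA a r q) rq ah.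
  by rewrite -z2ar -!ractM mulrA aq.
have hhr r : h * (h * r * h) * h = h * r * h by rewrite !mulrA hh -mulrA hh.
(* On the uniserial arm one of [a], [b] is the other times [h r h]. Were this factor in [J], the
   left relation between [a] and [b] and [radical_fix_r] would make them zero. *)
have [[r E]|[r E]] := ux s' s.
- have bar : b = a * (h * r * h) by rewrite !mulrA ah as' -E -bs' bh.
  apply: (fin (h * r * h)); rewrite ?hhr //; last by left; rewrite -ractM -bar.
  apply/negP => rJ; apply: a0; apply: (radical_fix_r (a := e * v * e) rJ).
  by rewrite {1}aE bar mulrA.
have abr : a = b * (h * r * h) by rewrite !mulrA bh bs' -E -as' ah.
apply: (fin (h * r * h)); rewrite ?hhr //; last by right; rewrite -z2b -ractM -abr.
apply/negP => rJ; apply: b0; apply: (radical_fix_r (a := u) rJ).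
by rewrite {1}bE {1}abr mulrA.
Qed.

Definition generator_with_socle e x y z1 b :=
  [/\ z1 |> e = z1, split_gen x y z1, z1 |> b = z, arm_element x y b &
      [/\ b \in J, e * b = b & b * h = b]].

(** [a] and [b] are comparable in [A h], say [b = u a]. A radical [u] gives the extension at once; a
    unit occurs only over equal idempotents, where rescaling [z2] yields [z1 a = z2 a = z]. *)
Lemma extends_generators e1 e2 x1 y1 x2 y2 z1 z2 a b :
  prim_idem e1 -> prim_idem e2 -> arms e1 x1 y1 -> arms e2 x2 y2 ->
  generator_with_socle e1 x1 y1 z1 a -> generator_with_socle e2 x2 y2 z2 b ->
  [/\ e1 = e2, x1 = x2 & y1 = y2] \/
  ((forall r, e1 * r * e2 \in J) /\ (forall r, e2 * r * e1 \in J)) ->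
  extends z z1 z2 \/ extends z z2 z1.
Proof.
move=> pe1 pe2 ar1 ar2 g1 g2 cases.
wlog [u bE] : e1 e2 x1 y1 x2 y2 z1 z2 a b pe1 pe2 ar1 ar2 g1 g2 cases / exists u, b = u * a.
  move=> H; have [_ _ _ _ [_ _ ah]] := g1; have [_ _ _ _ [_ _ bh]] := g2.
  have [ex|ex] := left_serial_comparable LS ph ah bh; last exact: (H e1 e2 x1 y1 x2 y2 z1 z2 a b).
  apply/or_comm; apply: (H e2 e1 x2 y2 x1 y1 z2 z1 b a) => //.
  by case: cases => [[-> -> ->]|[? ?]]; [left|right].
have [z1e sp1 z1a arma [aJ ea ah]] := g1; have [z2e sp2 z2b armb [bJ eb bh]] := g2.
have [ee1 _ _] := pe1; have [ee2 _ _] := pe2.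
have bE' : b = e2 * u * e1 * a by rewrite -!mulrA ea -bE eb.
have [uJ|nu] := boolP (e2 * u * e1 \in J).
  left; apply: (extends_radical (u := e2 * u * e1) pe1 ar1 z1e sp1 z1a arma ea) => //.
    by rewrite -mulrA ee1.
  by rewrite -bE'.
case: cases => [[E1 E2 E3]|[_ h2]]; last by rewrite h2 in nu.
subst e2 x2 y2.
have [||c c0 z2a] := arm_element_scalar pe1 ar1 aJ ea ah arma bJ eb bh armb (u := e1 * u * e1) _ _ nu bE' z2b.
- by rewrite !mulrA ee1.
- by rewrite -mulrA ee1.
have z3 a' : z2 |> (c *: 1) |> a' = z2 |> (c *: a').
  by rewrite -ractM -scalerAl mul1r.
have z2E : z2 = z2 |> (c *: 1) |> (c^-1 *: 1) by apply: ract_scalerK.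
have [|||ext|ext] := @extends_common e1 x1 y1 z1 (z2 |> (c *: 1)) a pe1 ar1 z1e _ sp1 _ z1a _ arma.
- by rewrite z3 -{2}z2e -ractM -scalerAr mulr1.
- by move=> s t; rewrite !z3 !scalerAr => st; apply: sp2 st.
- by rewrite z3.
- by left; apply: extends_genr ext.
- by right; apply: extends_genl z2E ext.
Qed.
End Socle.

(** If [e1 r e2] is outside [J], the generator [z1 e1 r e2] of the same module lives over [e2]. This
    leaves the two alternatives of [extends_generators]. *)
Lemma extends_total z f e1 e2 z1 z2 : prim_idem f -> prim_idem e1 -> prim_idem e2 ->
  z <> 0 -> z |> f = z -> (forall j, j \in J -> z |> j = 0) ->
  z1 |> e1 = z1 -> z2 |> e2 = z2 -> (exists a, z = z1 |> a) -> (exists a, z = z2 |> a) ->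
  extends z z1 z2 \/ extends z z2 z1.
Proof.
move=> pf pe1 pe2 z0 zf zJ z1e z2e za zb.
have [ff _ _] := pf.
have norm e y : prim_idem e -> y |> e = y -> (exists a, z = y |> a) ->
    exists a, [/\ e * a = a, a * f = a & z = y |> a].
  move=> [ee _ _] ye [a zE]; exists (e * a * f); split.
  - by rewrite !mulrA ee.
  - by rewrite -mulrA ff.
  - by rewrite !ractM ye -zE zf.
(* Here [y1] lies in [z A], so the map is determined by fixing [z]. *)
have simple y1 y2 e a : prim_idem e -> y1 |> e = y1 -> e * a = a -> z = y1 |> a ->
    a \notin J -> (exists b, z = y2 |> b) -> extends z y1 y2.
  move=> pe y1e ea zE na [b zE']; have [r ar] := right_inv pe ea na.
  by exists (b * r) => p q <-; rewrite !ractM -zE' zE -(ractM y1) ar y1e.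
have gen e y a' : prim_idem e -> y |> e = y -> e * a' = a' -> a' * f = a' -> a' \in J ->
    z = y |> a' -> forall x0 y0, arms e x0 y0 ->
    exists y' b', [/\ generator_with_socle z f e x0 y0 y' b', exists u, y' = y |> u & exists v, y = y' |> v].
  move=> pe ye ea' af' aJ' zE0 x0 y0 ar.
  have [y' [b' [[ye' sp] u v [bJ' eb' bf'] [zb' armb]]]] :=
    split_gen_socle pf zf zJ pe ar ye aJ' ea' af' (esym zE0).
  by exists y', b'; split.
have finish e1' e2' x1 y1 x2 y2 w1 w2 : prim_idem e1' -> prim_idem e2' ->
    w1 |> e1' = w1 -> w2 |> e2' = w2 -> (exists a, z = w1 |> a) -> (exists b, z = w2 |> b) ->
    arms e1' x1 y1 -> arms e2' x2 y2 ->
    [/\ e1' = e2', x1 = x2 & y1 = y2] \/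
      ((forall r, e1' * r * e2' \in J) /\ (forall r, e2' * r * e1' \in J)) ->
    extends z w1 w2 \/ extends z w2 w1.
  move=> p1 p2 we1 we2 wa wb ar1 ar2 cases.
  have [a [ea af zE]] := norm _ _ p1 we1 wa.
  have [aJ|na] := boolP (a \in J); last by left; apply: (simple w1 w2 e1' a).
  have [b [eb bf zE']] := norm _ _ p2 we2 wb.
  have [bJ|nb] := boolP (b \in J); last by right; apply: (simple w2 w1 e2' b).
  have [v1 [c1 [g1 [u1 u1E] [u1' u1'E]]]] := gen _ _ _ p1 we1 ea af aJ zE _ _ ar1.
  have [v2 [c2 [g2 [u2 u2E] [u2' u2'E]]]] := gen _ _ _ p2 we2 eb bf bJ zE' _ _ ar2.
  have [ext|ext] := extends_generators pf z0 zf zJ p1 p2 ar1 ar2 g1 g2 cases.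
    by left; apply: extends_genl u1'E _; apply: extends_genr u2E ext.
  by right; apply: extends_genl u2'E _; apply: extends_genr u1E ext.
have iso e e' y1 y2 r : prim_idem e -> prim_idem e' -> y1 |> e = y1 -> y2 |> e' = y2 ->
    (exists a, z = y1 |> a) -> (exists b, z = y2 |> b) -> e * r * e' \notin J ->
    extends z y1 y2 \/ extends z y2 y1.
  move=> pe pe' y1e y2e ya yb nr; have [ee _ _] := pe; have [ee' _ _] := pe'.
  have [|v vE] := right_inv pe _ nr; first by rewrite !mulrA ee.
  have wE : y1 = y1 |> (e * r * e') |> v by rewrite -ractM vE.
  have we : y1 |> (e * r * e') |> e' = y1 |> (e * r * e') by rewrite -ractM -!mulrA ee'.
  have [x [y ar]] := AR pe'.
  have wa : exists a, z = y1 |> (e * r * e') |> a.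
    by case: ya => a ->; exists (v * a); rewrite [RHS]ractM -wE.
  have [ext|ext] := finish _ _ _ _ _ _ _ _ pe' pe' we y2e wa yb ar ar (or_introl (And3 erefl erefl erefl)).
    by left; apply: extends_genl wE ext.
  by right; apply: extends_genr (erefl _) ext.
have notall e e' : ~ (forall r, e * r * e' \in J) -> exists r, e * r * e' \notin J.
  by move=> N; apply: contra_notP N => H r; apply/negPn/negP => nr; apply: H; exists r.
have [h12|/notall[r nr]] := pselect (forall r, e1 * r * e2 \in J); last first.
  exact: (iso e1 e2 z1 z2 r).
have [h21|/notall[r nr]] := pselect (forall r, e2 * r * e1 \in J); last first.
  by apply/or_comm; apply: (iso e2 e1 z2 z1 r).
have [x1 [y1 ar1]] := AR pe1; have [x2 [y2 ar2]] := AR pe2.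
by apply: (finish _ _ _ _ _ _ _ _ pe1 pe2 z1e z2e za zb ar1 ar2); right.
Qed.
End Module.
End Extension.

(** * Quotients and submodules as modules *)

Section Quotient.
Local Open Scope quotient_scope.
Variables (R : nzRingType) (M : lmodType R) (Z : zmodClosed M).
Hypothesis ZZ : forall a x, x \in Z -> a *: x \in Z.
Local Notation Q := (Quotient.quot Z).

Definition quot_scale (a : R) (x : Q) : Q := \pi_Q (a *: repr x).

Lemma pi_quot_scale a (x : M) : \pi_Q (a *: x) = quot_scale a (\pi_(Q) x).
Proof.
apply/eqP; rewrite /quot_scale -Quotient.idealrBE -scalerBr.
by rewrite ZZ // Quotient.idealrBE reprK.
Qed.

Lemma quot_scaleA a b x : quot_scale a (quot_scale b x) = quot_scale (a * b) x.
Proof. by elim/quotW: x => x; rewrite -(pi_quot_scale b) -(pi_quot_scale a)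
  -(pi_quot_scale (a * b)) scalerA. Qed.

Lemma quot_scale1 : left_id 1 quot_scale.
Proof. by elim/quotW=> x; rewrite -pi_quot_scale scale1r. Qed.

Lemma pi_quotD (x y : M) : \pi_Q (x + y) = \pi_Q x + \pi_Q y.
Proof. by rewrite piE. Qed.

Lemma quot_scaleDr : right_distributive quot_scale +%R.
Proof.
by move=> a; elim/quotW=> x; elim/quotW=> y; rewrite -pi_quotD -(pi_quot_scale a x)
  -(pi_quot_scale a y) -(pi_quot_scale a (x + y)) -pi_quotD scalerDr.
Qed.

Lemma quot_scaleDl (x : Q) : {morph quot_scale^~ x : a b / a + b}.
Proof.
by move=> a b; elim/quotW: x => x; rewrite -(pi_quot_scale a)
  -(pi_quot_scale b) -(pi_quot_scale (a + b)) -pi_quotD scalerDl.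
Qed.

Lemma quotient_module_ex : exists (Q : lmodType R) (p : {linear M -> Q}),
  (forall x, p x = 0 <-> x \in Z) /\ forall y, exists x, p x = y.
Proof.
pose L := GRing.Zmodule_isLmodule.Build R Q
  quot_scaleA quot_scale1 quot_scaleDr quot_scaleDl.
pose QL : lmodType R := HB.pack Q L.
have lin : linear (\pi_Q : M -> QL) by move=> a x y; rewrite pi_quotD pi_quot_scale.
pose pL := GRing.isLinear.Build R M QL _ (\pi_Q : M -> QL) lin.
pose p : {linear M -> QL} := HB.pack (\pi_Q : M -> QL) pL.
exists QL, p; split=> [x|y]; last by exists (repr y); rewrite /= reprK.
rewrite -(raddf0 p) /=; split=> [/eqP|Zx].
  by rewrite -Quotient.idealrBE subr0.
by apply/eqP; rewrite -Quotient.idealrBE subr0.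
Qed.
End Quotient.

Section Submodule.
Variables (R : nzRingType) (M : lmodType R) (U : zmodClosed M).

Definition sub_sort := {y : M | y \in U}.
HB.instance Definition _ := SubType.on sub_sort.
HB.instance Definition _ := Choice.on sub_sort.
HB.instance Definition _ := [SubChoice_isSubZmodule of sub_sort by <:].

Hypothesis UZ : forall a x, x \in U -> a *: x \in U.

Definition sub_scale a (x : sub_sort) : sub_sort := Sub (a *: val x) (UZ a (valP x)).

Lemma submodule_module_ex : exists (S : lmodType R) (i : {linear S -> M}),
  injective i /\ forall x, x \in U <-> exists s, i s = x.
Proof.
have vscale a x : val (sub_scale a x) = a *: val x by rewrite SubK.
have vD (x y : sub_sort) : val (x + y) = val x + val y by exact: (raddfD val).
have sA a b x : sub_scale a (sub_scale b x) = sub_scale (a * b) x.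
  by apply: val_inj; rewrite !vscale scalerA.
have s1 : left_id 1 sub_scale by move=> x; apply: val_inj; rewrite vscale scale1r.
have sDr : right_distributive sub_scale +%R.
  by move=> a x y; apply: val_inj; rewrite vD !vscale vD scalerDr.
have sDl x : {morph sub_scale^~ x : a b / a + b}.
  by move=> a b; apply: val_inj; rewrite vD !vscale scalerDl.
pose L := GRing.Zmodule_isLmodule.Build R sub_sort sA s1 sDr sDl.
pose S : lmodType R := HB.pack sub_sort L.
have lin : linear (val : S -> M) by move=> a x y; rewrite vD; congr (_ + _); exact: vscale.
pose pL := GRing.isLinear.Build R S M _ (val : S -> M) lin.
pose p : {linear S -> M} := HB.pack (val : S -> M) pL.
exists S, p; split=> [x y|x]; first exact: val_inj.
split=> [Ux|[s <-]]; last exact: (valP s).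
by exists (Sub x Ux); apply: SubK.
Qed.
End Submodule.

Section SubmoduleSets.
Variables (A : nzRingType) (M : lmodType A^c).
Implicit Types U V Z : set M.
Local Open Scope classical_set_scope.

Lemma submoduleP U : submodule U <->
  U 0 /\ forall a u v, U u -> U v -> U (u |> a + v).
Proof.
split=> [[U0 UL]|[U0 UL]].
  split=> [|a u v Uu Uv]; first by have := U0; rewrite inE.
  by have := UL a u v; rewrite !inE; apply.
split=> [|a u v]; rewrite !inE //; exact: UL.
Qed.

Lemma submodule0 U : submodule U -> U 0. Proof. by move=> /submoduleP[]. Qed.

Lemma submoduleD U u v : submodule U -> U u -> U v -> U (u + v).
Proof. by move=> /submoduleP[_ UL] Uu Uv; have := UL 1 u v Uu Uv; rewrite ract1. Qed.

Lemma submodule_ract U u a : submodule U -> U u -> U (u |> a).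
Proof. by move=> /submoduleP[U0 UL] Uu; rewrite -[_ |> _]addr0; apply: UL. Qed.

Lemma submoduleN U u : submodule U -> U u -> U (- u).
Proof. by move=> sU /(submodule_ract (-1) sU); rewrite ractNr ract1. Qed.

Lemma submoduleB U u v : submodule U -> U u -> U v -> U (u - v).
Proof. by move=> sU Uu Uv; apply: submoduleD => //; apply: submoduleN. Qed.

Lemma submodule_sum U (I : finType) (F : I -> M) : submodule U ->
  (forall i, U (F i)) -> U (\sum_i F i).
Proof.
move=> sU UF; elim/big_ind: _ => //; first exact: submodule0.
by move=> u v; apply: submoduleD.
Qed.

Lemma zmod_closed_of_submodule U : submodule U -> exists Z : zmodClosed M,
  (forall x, x \in Z <-> U x) /\ forall (a : A^c) x, x \in Z -> a *: x \in Z.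
Proof.
move=> sU; have zU : zmod_closed (mem U).
  split=> [|u v]; rewrite !inE; [exact: submodule0|exact: submoduleB].
pose ZL := GRing.isZmodClosed.Build M (mem U) zU.
pose Z : zmodClosed M := HB.pack (mem U : {pred M}) ZL.
have ZE x : x \in Z <-> U x by rewrite -topredE /= inE.
by exists Z; split=> // a x /ZE Ux; apply/ZE; apply: submodule_ract.
Qed.

Lemma quotient_by Z : submodule Z -> exists (Q : lmodType A^c) (p : {linear M -> Q}),
  (forall x, p x = 0 <-> Z x) /\ forall y, exists x, p x = y.
Proof.
move=> /zmod_closed_of_submodule[C [CE CZ]].
have [Q [p [pE psurj]]] := quotient_module_ex CZ.
by exists Q, p; split=> // x; rewrite pE CE.
Qed.

Lemma embedding_of U : submodule U -> exists (S : lmodType A^c) (i : {linear S -> M}),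
  injective i /\ forall x, U x <-> exists s, i s = x.
Proof.
move=> /zmod_closed_of_submodule[C [CE CZ]].
have [S [i [iinj iE]]] := submodule_module_ex CZ.
by exists S, i; split=> // x; rewrite -iE CE.
Qed.

Lemma linear_ract (N : lmodType A^c) (f : {linear M -> N}) x a : f (x |> a) = f x |> a.
Proof. exact: linearZ. Qed.
End SubmoduleSets.

Local Open Scope classical_set_scope.

(** * Decomposition into local modules *)

Section Rank.
Variables (k : fieldType) (A : falgType k).

(** A submodule is measured by the [k]-dimension of its preimage in [A^n] under a generating map;
    this replaces length in the inductions. *)
Lemma fg_rank (M : lmodType A^c) : finitely_generated M ->
  exists (d : set M -> nat) (N : nat), (forall U, (d U <= N)%N) /\
  forall U V, submodule U -> submodule V -> U `<=` V -> ~ (V `<=` U) -> (d U < d V)%N.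
Proof.
move=> [n [g gP]].
pose p (a : {ffun 'I_n -> A}) : M := \sum_i g i |> a i.
have /choice[W WP] : forall U : set M, exists W : {vspace {ffun 'I_n -> A}},
    submodule U -> forall a, a \in W <-> U (p a).
  move=> U; have [sU|nsU] := pselect (submodule U); last by exists 0%VS.
  have [||W WP] := @vspace_of_pred k {ffun 'I_n -> A} (fun a => U (p a)).
  - rewrite /p big1 ?[U 0]submodule0 // => [|i _]; last by rewrite ffunE ract0.
    exact: submodule0.
  - move=> c u v Uu Uv.
    have -> : p (c *: u + v) = p u |> (c *: 1) + p v.
      rewrite /p ract_suml -big_split /=; apply: eq_bigr => i _.
      by rewrite !ffunE ractDr -ractM -scalerAr mulr1.
    by apply: submoduleD => //; apply: submodule_ract.
  by exists W.
exists (fun U => \dim (W U)), (\dim {:{ffun 'I_n -> A}}); split=> [U|U V sU sV UV nVU].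
  by rewrite dimvS ?subvf.
have sub : (W U <= W V)%VS.
  by apply/subvP => a /(WP U sU) Ua; apply/(WP V sV); apply: UV.
rewrite ltnNge; apply/negP => le; apply: nVU => x Vx.
have [a xE] := gP x; have {}xE : x = p [ffun i => a i].
  by rewrite xE; apply: eq_bigr => i _; rewrite ffunE.
have /eqP eW : W U == W V by rewrite eqEdim sub le.
by rewrite xE; apply/(WP U sU); rewrite eW; apply/(WP V sV); rewrite -xE.
Qed.

End Rank.

Lemma sum_option (V : nmodType) (I : finType) (F : option I -> V) :
  \sum_o F o = F None + \sum_i F (Some i).
Proof.
rewrite (bigD1 None) //=; congr (_ + _).
rewrite (reindex_omap (op:=+%R) Some id) //=; last by case.
by apply: eq_bigl => i; rewrite eqxx.
Qed.

Section Decomposition.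
Variables (k : closedFieldType) (A : falgType k).
Local Notation J := (radical A).
Hypotheses (LS : left_serial A)
  (AR : forall e : A, prim_idem e -> exists x y, arms e x y).

Section FixedModule.
Variable M : lmodType A^c.
Implicit Types (Z U V : set M) (z x : M).

(** A decomposition of [M / Z] into cyclic modules, local or zero, kept on representatives in [M] so
    that [Z] can vary. *)
Definition local_decomposition Z (I : finType) (x : I -> M) (e : I -> A) :=
  [/\ forall i, prim_idem (e i) /\ x i |> e i = x i,
      forall m, exists a : I -> A, Z (m - \sum_i x i |> a i) &
      forall a : I -> A, Z (\sum_i x i |> a i) -> forall i, Z (x i |> a i)].

(** Passing from [m] to some [m j] outside [Z] must stop, by nilpotency of [J], at a vector whose
    [J]-multiples lie in [Z]. *)
Lemma socle_vector_ex Z : submodule Z -> Z <> setT ->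
  exists z f, [/\ prim_idem f, ~ Z z, z |> f = z & forall j, j \in J -> Z (z |> j)].
Proof.
move=> sZ ZT; have [m nZm] : exists m, ~ Z m.
  by apply: contra_notP ZT => h; apply/seteqP; split=> // m _; apply: contrapT => nm; apply: h; exists m.
have [N JN] := radical_nilpotent A.
suff [z nZz zJ] : exists2 z, ~ Z z & forall j, j \in J -> Z (z |> j).
  have [s [ps s1]] := prim_decomposition A.
  have [f pf nf] : exists2 f, prim_idem f & ~ Z (z |> f).
    apply: contrapT => h; apply: nZz; rewrite -[z]ract1 -s1 ract_sumr big_seq.
    elim/big_ind: _ => [|u v|f fs]; [exact: submodule0|exact: submoduleD|].
    by apply: contrapT => nf; apply: h; exists f => //; exact: ps.
  have [ff _ _] := pf; exists (z |> f), f; split=> //; first by rewrite -ractM ff.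
  by move=> j jJ; rewrite -ractM; apply: zJ; rewrite radical_mull.
have : forall j, j \in (J ^+ N.+1)%VS -> Z (m |> j).
  by move=> j; rewrite expvSl JN prodv0 memv0 => /eqP->; rewrite ract0; exact: submodule0.
elim: N.+1 => [|n IHn] in m nZm *.
  by move=> /(_ 1 (memv_line 1)); rewrite ract1.
move=> mJ; have [all|] := pselect (forall j, j \in J -> Z (m |> j)); first by exists m.
move=> h; have [j jJ nj] : exists2 j, j \in J & ~ Z (m |> j).
  by apply: contra_notP h => h j jJ; apply: contrapT => nj; apply: h; exists j.
by apply: (IHn _ nj) => i iJ; rewrite -ractM; apply: mJ; rewrite expvSl memv_mul.
Qed.

Section Step.
Variables (Z : set M) (z : M) (f : A).
Hypotheses (sZ : submodule Z) (pf : prim_idem f) (nZz : ~ Z z) (zf : z |> f = z)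
  (zJ : forall j, j \in J -> Z (z |> j)).

Definition line_over : set M := [set w | exists b, Z (w - z |> b)].
Local Notation Z' := line_over.

Lemma line_over_submodule : submodule Z'.
Proof.
apply/submoduleP; split=> [|a u v [b hb] [c hc]].
  by exists 0; rewrite ract0 subr0; exact: submodule0.
exists (b * a + c); rewrite ractDr ractM opprD addrACA -ractBl.
by apply: submoduleD => //; apply: submodule_ract.
Qed.

Lemma sub_line_over : Z `<=` Z'.
Proof. by move=> w Zw; exists 0; rewrite ract0 subr0. Qed.

Lemma line_over_vector : Z' z.
Proof. by exists 1; rewrite ract1 subrr; exact: submodule0. Qed.

Lemma line_over_inv b : ~ Z (z |> b) -> exists r, Z (z |> b |> r - z).
Proof.
move=> nb; have [ff _ _] := pf.
have [bJ|nfb] := boolP (f * b \in J); first by case: nb; rewrite -zf -ractM; exact: zJ.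
have [|r rE] := right_inv pf _ nfb; first by rewrite mulrA ff.
by exists r; rewrite -{1}zf -!ractM mulrA rE zf subrr; exact: submodule0.
Qed.

Definition reaches x := exists a, Z (z - x |> a).

Lemma not_reaches x a : ~ reaches x -> Z' (x |> a) -> Z (x |> a).
Proof.
move=> nx [b hb]; apply: contrapT => nxa.
have nb : ~ Z (z |> b) by move=> zb; apply: nxa; rewrite -(subrK (z |> b) (x |> a)); exact: submoduleD.
have [r hr] := line_over_inv nb; apply: nx; exists (a * r).
have -> : z - x |> (a * r) = - ((x |> a - z |> b) |> r + (z |> b |> r - z)).
  by rewrite ractBl addrA subrK ractM opprB.
by apply: submoduleN => //; apply: submoduleD => //; apply: submodule_ract.
Qed.

Lemma extends_mod x1 x2 e1 e2 : prim_idem e1 -> prim_idem e2 -> x1 |> e1 = x1 -> x2 |> e2 = x2 ->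
  reaches x1 -> reaches x2 ->
  (exists r, forall a b, Z (x1 |> a - z |> b) -> Z (x2 |> (r * a) - z |> b)) \/
  (exists r, forall a b, Z (x2 |> a - z |> b) -> Z (x1 |> (r * a) - z |> b)).
Proof.
move=> pe1 pe2 xe1 xe2 [a1 h1] [a2 h2].
have [Q [p [pE _]]] := quotient_by sZ.
have pZ u v : Z (u - v) <-> p u = p v.
  split=> [/pE|uv]; first by rewrite linearB => /subr0_eq.
  by apply/pE; rewrite linearB uv subrr.
have tr y1 y2 : extends (p z) (p y1) (p y2) ->
    exists r, forall a b, Z (y1 |> a - z |> b) -> Z (y2 |> (r * a) - z |> b).
  by move=> [r h]; exists r => a b; rewrite !pZ !linear_ract; apply: h.
have [|||||||ext|ext] := @extends_total k A LS AR Q (p z) f e1 e2 (p x1) (p x2) pf pe1 pe2.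
- by move=> /pE.
- by rewrite -linear_ract zf.
- by move=> j jJ; rewrite -linear_ract; apply/pE; apply: zJ.
- by rewrite -linear_ract xe1.
- by rewrite -linear_ract xe2.
- by exists a1; rewrite -linear_ract; apply/pZ.
- by exists a2; rewrite -linear_ract; apply/pZ.
- by left; apply: tr.
- by right; apply: tr.
Qed.

(** Induction on the number of summands containing [z] modulo [Z]. With none, [z] is a new
    generator; with one, the family already decomposes [M / Z]; with two, one generator is corrected
    by a multiple of the other. *)
Lemma local_decomposition_step (I : finType) (x : I -> M) (e : I -> A) :
  local_decomposition Z' x e ->
  exists (I' : finType) (x' : I' -> M) (e' : I' -> A), local_decomposition Z x' e'.
Proof.
pose S (x : I -> M) := [set i | `[< reaches (x i) >]]%SET.
have [c] := ubnP #|S x|; elim: c x e => // c IHc x e ltc [xe span indep].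
have sZ' := line_over_submodule.
have [S0|[i0 Si0]] := set_0Vmem (S x).
  have nr i : ~ reaches (x i).
    move=> ri; have : i \in S x by rewrite finset.in_set; apply/asboolP.
    by rewrite S0 finset.in_set0.
  pose x' (o : option I) := if o is Some i then x i else z.
  pose e' (o : option I) := if o is Some i then e i else f.
  have sumE (a : option I -> A) :
      \sum_o x' o |> a o = z |> a None + \sum_i x i |> a (Some i).
    exact: sum_option.
  exists (option I), x', e'; split=> [[i|] //=|m|a].
  - by have [a [b hb]] := span m; exists (oapp a b); rewrite sumE (addrC (z |> _)) opprD addrA.
  - rewrite sumE => Za.
    have Zi i : Z (x i |> a (Some i)).
      apply: not_reaches (nr i) _; apply: (indep (fun i => a (Some i))); exists (- a None).
      by rewrite ractNr opprK [_ + z |> _]addrC.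
    have Zz : Z (z |> a None).
      rewrite -(addrK (\sum_i x i |> a (Some i)) (z |> _)).
      by apply: submoduleB => //; apply: submodule_sum.
    by case=> [i|]; [exact: Zi|exact: Zz].
have r0 : reaches (x i0) by move: Si0; rewrite finset.in_set => /asboolP.
have [[j ji0 rj]|S1] := pselect (exists2 j, j <> i0 & reaches (x j)); last first.
  have nr i : i <> i0 -> ~ reaches (x i) by move=> ii0 ri; apply: S1; exists i.
  have [a0 ha0] := r0.
  exists I, x, e; split=> [//|m|a Za].
    have [a [b hb]] := span m.
    exists (fun i => if i == i0 then a i + a0 * b else a i).
    have -> : \sum_i x i |> (if i == i0 then a i + a0 * b else a i) =
        \sum_i x i |> a i + x i0 |> (a0 * b).
      rewrite (bigD1 i0) //= eqxx ractDr addrAC [in RHS](bigD1 i0) //=.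
      by congr (_ + _ + _); apply: eq_bigr => i /negPf->.
    rewrite opprD addrA.
    have -> : m - \sum_i x i |> a i - x i0 |> (a0 * b) =
        (m - \sum_i x i |> a i - z |> b) + (z - x i0 |> a0) |> b.
      by rewrite ractBl -ractM addrA subrK.
    by apply: submoduleD => //; apply: submodule_ract.
  have Z'a i : Z' (x i |> a i) by apply: (indep a); apply: sub_line_over.
  have Zi i : i <> i0 -> Z (x i |> a i) by move=> ii0; apply: not_reaches (nr i ii0) _.
  move=> i; have [->|/eqP ii0] := eqVneq i i0; last exact: Zi.
  move: Za; rewrite (bigD1 i0) //= => Za.
  rewrite -(addrK (\sum_(i | i != i0) x i |> a i) (x i0 |> _)).
  apply: submoduleB => //; elim/big_ind: _ => [|u v|i1 /eqP]; [exact: submodule0|exact: submoduleD|exact: Zi].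
have reduce i j' : i <> j' -> reaches (x i) ->
    (exists r, forall a b, Z (x i |> a - z |> b) -> Z (x j' |> (r * a) - z |> b)) ->
    exists (I' : finType) (x' : I' -> M) (e' : I' -> A), local_decomposition Z x' e'.
  (* The factor [e i] ensures that the corrected generator is still fixed by [e i]. *)
  move=> ij ri [r0' hr0]; pose r := r0' * e i.
  have [_ xie] := xe i.
  have hr a b : Z (x i |> a - z |> b) -> Z (x j' |> (r * a) - z |> b).
    by move=> h; rewrite -mulrA; apply: hr0; rewrite ractM xie.
  pose x' l := if l == i then x i - x j' |> r else x l.
  have x'i a : x' i |> a = x i |> a - x j' |> (r * a).
    by rewrite /x' eqxx ractBl -ractM.
  have x'l l : l <> i -> x' l = x l by rewrite /x' => /eqP/negPf->.
  (* The map [x i |-> x j' r] fixes [z], so the multiples of [z] cancel in the difference. *)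
  have Zx'i a : Z' (x i |> a) -> Z (x' i |> a).
    move=> [b h]; rewrite x'i.
    have -> : x i |> a - x j' |> (r * a) = (x i |> a - z |> b) - (x j' |> (r * a) - z |> b).
      by rewrite opprB addrA subrK.
    by apply: submoduleB => //; apply: hr.
  have sumx' (a : I -> A) : \sum_l x' l |> a l = \sum_l x l |> a l - x j' |> (r * a i).
    rewrite (bigD1 i) //= x'i [in RHS](bigD1 i) //= addrAC; congr (_ + _ - _).
    by apply: eq_bigr => l /eqP li; rewrite x'l.
  have sumx (a : I -> A) b : \sum_l x l |> (if l == j' then a l + b else a l) =
      \sum_l x l |> a l + x j' |> b.
    rewrite (bigD1 j') //= eqxx ractDr [in RHS](bigD1 j') //= addrAC; congr (_ + _ + _).
    by apply: eq_bigr => l /negPf->.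
  have key (a : I -> A) : Z' (\sum_l x' l |> a l) -> Z (x' i |> a i) /\ forall l, Z' (x l |> a l).
    rewrite sumx' -ractNr -sumx => /(indep (fun l => if l == j' then a l - r * a i else a l)) Za.
    have Zi : Z' (x i |> a i) by have := Za i; rewrite (introF eqP ij).
    split=> [|l]; first exact: Zx'i.
    have := Za l; case: eqVneq => [->|//] /= Zj; rewrite -(subrK (r * a i) (a j')) ractDr.
    apply: submoduleD => //.
    have [b h] := Zi; exists b; exact: hr.
  apply: (IHc x' e); last split=> [l|m|a Za l].
  - rewrite -ltnS (leq_trans _ ltc) // ltnS; apply: proper_card.
    apply/fintype.properP; split.
      apply/fintype.subsetP => l; rewrite !finset.in_set => /asboolP rl; apply/asboolP.
      by have [->//|/eqP li] := eqVneq l i; rewrite -x'l.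
    exists i; rewrite finset.in_set; apply/asboolP => //.
    (* If a multiple of the new generator were [z] modulo [Z], it would lie in [Z'], hence in [Z] by
       [key], and so would [z]. *)
    move=> [a h].
    have [|Zi _] := key (fun l => if l == i then a else 0).
      rewrite (bigD1 i) //= eqxx big1 => [|l /negPf->]; last by rewrite ract0.
      rewrite addr0 -[x' i |> a](subKr z); apply: submoduleB => //; first exact: line_over_vector.
      exact: sub_line_over.
    rewrite eqxx in Zi; apply: nZz; rewrite -[z](subrK (x' i |> a)).
    exact: submoduleD.
  - have [pl xle] := xe l; split=> //; have [->|/eqP li] := eqVneq l i; last by rewrite x'l.
    by have [[ee _ _] _] := xe i; rewrite x'i xie -mulrA ee /x' eqxx.
  - have [a h] := span m; exists (fun l => if l == j' then a l + r * a i else a l).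
    by rewrite sumx' sumx (introF eqP ij) addrK.
  - have [Zi Zl] := key a Za.
    have [->|/eqP li] := eqVneq l i; first exact: sub_line_over.
    by rewrite x'l.
have [pj xj] := xe j; have [pi0 xi0] := xe i0.
have [h|h] := extends_mod pj pi0 xj xi0 rj r0.
  exact: (reduce j i0).
by apply: (reduce i0 j) => //; apply: nesym.
Qed.
End Step.

Theorem local_decomposition_ex : @finitely_generated A M ->
  exists (I : finType) (x : I -> M) (e : I -> A),
  [/\ forall i, prim_idem (e i) /\ x i |> e i = x i,
      forall m, exists a : I -> A, m = \sum_i x i |> a i &
      forall a : I -> A, \sum_i x i |> a i = 0 -> forall i, x i |> a i = 0].
Proof.
move=> fgM; have [d [N [dN dlt]]] := fg_rank fgM.
suff [I [x [e [xe span indep]]]] : exists (I : finType) (x : I -> M) (e : I -> A),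
    local_decomposition [set 0] x e.
  exists I, x, e; split=> // m.
  by have [a /subr0_eq ->] := span m; exists a.
have s0 : submodule [set (0 : M)].
  by apply/submoduleP; split=> // a u v -> ->; rewrite ract0l addr0.
suff main Z : submodule Z -> exists (I : finType) (x : I -> M) (e : I -> A),
    local_decomposition Z x e by exact: main.
have [c] := ubnP (N - d Z); elim: c Z => // c IHc Z ltc sZ.
have [ZT|ZT] := pselect (Z = setT).
  exists void, (of_void M), (of_void A).
  by split=> [[]|m|a _ []]; exists (fun=> 0); rewrite ZT.
have [z [f [pf nZz zf zJ]]] := socle_vector_ex sZ ZT.
have sZ' := line_over_submodule z sZ.
have [||I [x [e dec]]] := IHc (line_over Z z) => //.
  rewrite -ltnS (leq_trans _ ltc) // ltnS ltn_sub2l //.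
    apply: leq_trans (dN (line_over Z z)); apply: dlt => //; first exact: sub_line_over.
    by move=> /(_ z (line_over_vector z sZ)).
  apply: dlt => //; first exact: sub_line_over.
  by move=> /(_ z (line_over_vector z sZ)).
exact: (local_decomposition_step sZ pf nZz zf zJ dec).
Qed.
End FixedModule.
End Decomposition.

(** * Pretorsion classes defined by linear conditions *)

Section PPClasses.
Variable A : nzRingType.
Implicit Types (s : seq (A * A)) (ss : seq (seq (A * A))).

Fixpoint solves (M : lmodType A^c) s (x y : M) : Prop :=
  if s is p :: s' then x |> p.1 = y |> p.2 /\ solves s' x y else True.

(** Each [s] gives a positive primitive formula in [x] with one bound variable; [pp_on] asks that
    every formula of the list hold throughout [U], with witnesses in [U]. *)
Fixpoint pp_on (M : lmodType A^c) ss (U : set M) : Prop :=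
  if ss is s :: ss' then
    (forall x, U x -> exists2 y, U y & solves s x y) /\ pp_on ss' U
  else True.

Lemma solves_linear (M N : lmodType A^c) (f : {linear M -> N}) s x y :
  solves s x y -> solves s (f x) (f y).
Proof. by elim: s => //= p s IHs [e /IHs]; split=> //; rewrite -!linear_ract e. Qed.

Lemma solves_inj (M N : lmodType A^c) (f : {linear M -> N}) s x y :
  injective f -> solves s (f x) (f y) -> solves s x y.
Proof.
by move=> fi; elim: s => //= p s IHs [e /IHs]; split=> //; apply: fi; rewrite !linear_ract e.
Qed.

Lemma solves_pair (M N : lmodType A^c) s (x y : M) (x' y' : N) :
  solves s x y -> solves s x' y' -> @solves (M * N)%type s (x, x') (y, y').
Proof. by elim: s => //= p s IHs [e h] [e' h']; split; [congr pair|apply: IHs]. Qed.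

Lemma pp_on_image (M N : lmodType A^c) (f : {linear M -> N}) ss :
  (forall y, exists x, f x = y) -> @pp_on M ss setT -> @pp_on N ss setT.
Proof.
move=> fs; elim: ss => //= s ss IHs [h /IHs]; split=> // y _; have [x <-] := fs y.
by have [x' _ sx] := h x I; exists (f x') => //; apply: solves_linear.
Qed.

Lemma pp_on_embedding (M N : lmodType A^c) (f : {linear M -> N}) ss (U : set N) :
  injective f -> (forall y, U y <-> exists x, f x = y) ->
  pp_on ss U <-> @pp_on M ss setT.
Proof.
move=> fi fU; elim: ss => //= s ss IHs; split=> -[h /IHs h']; split=> //.
  move=> x _; have [|y /fU[x' <-] sxy] := h (f x); first by apply/fU; exists x.
  by exists x' => //; apply: solves_inj sxy.
move=> _ /fU[x <-]; have [y _ sxy] := h x I; exists (f y); first by apply/fU; exists y.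
exact: solves_linear.
Qed.

Definition pp_class ss : pretorsion_class A.
Proof.
refine (@PretorsionClass A (fun M => @pp_on M ss setT) _ _ _ _).
- move=> M N f [g _ fg]; apply: pp_on_image => y; exists (g y); exact: fg.
- move=> M M0; elim: ss => //= s ss IHs; split=> // x _; exists 0 => //.
  by elim: s => //= p s IHs'; split=> //; rewrite (M0 (x |> _)) ract0l.
- by move=> M N f; apply: pp_on_image.
- move=> M N; elim: ss => //= s ss IHs [h1 /IHs h2] [h1' /h2]; split=> // -[x x'] _.
  have [y _ sy] := h1 x I; have [y' _ sy'] := h1' x' I.
  by exists (y, y') => //; apply: solves_pair.
Defined.

Lemma distributive_le (R S T W : pretorsion_class A) : pretorsion_lattice_distributive A ->
  (forall X, R X -> S X -> W X) -> (forall X, R X -> T X -> W X) ->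
  forall (X Y M : modf A) (f : {linear (X * Y)%type -> M}),
  (forall m, exists u, f u = m) -> S X -> T Y -> R M -> W M.
Proof.
move=> dist RS RT X Y M f fs SX TY RM.
have : pretorsion_meet R (pretorsion_join S T) M.
  split=> // V hV; apply: (@pretorsion_quotient _ _ (modf_prod X Y) M f fs).
  by apply: pretorsion_sum; apply: hV; [left|right].
by rewrite dist; apply=> N [[]|[]]; [apply: RS|apply: RT].
Qed.

Definition cyclic (V : lmodType A^c) (x : V) : set V := [set y | exists a, y = x |> a].
Definition bicyclic (V : lmodType A^c) (x y : V) : set V :=
  [set u | exists a b, u = x |> a + y |> b].

Lemma cyclic_submodule (V : lmodType A^c) (x : V) : submodule (cyclic x).
Proof.
apply/submoduleP; split=> [|a _ _ [b ->] [c ->]]; first by exists 0; rewrite ract0.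
by exists (b * a + c); rewrite ractDr ractM.
Qed.

Lemma bicyclic_submodule (V : lmodType A^c) (x y : V) : submodule (bicyclic x y).
Proof.
apply/submoduleP; split=> [|a _ _ [b [c ->]] [b' [c' ->]]].
  by exists 0, 0; rewrite !ract0 addr0.
exists (b * a + b'), (c * a + c').
by rewrite !ractDr !ractM ractDl addrACA.
Qed.

(** The test module [x A + y A] is a quotient of [x A (+) y A]. Keeping all three as subsets of one
    [V] lets the conditions be checked on elements of [V]. *)
Lemma distributive_pp (rs ss ts ws : seq (seq (A * A))) : pretorsion_lattice_distributive A ->
  (forall X : modf A, @pp_on X rs setT -> @pp_on X ss setT -> @pp_on X ws setT) ->
  (forall X : modf A, @pp_on X rs setT -> @pp_on X ts setT -> @pp_on X ws setT) ->
  forall (V : lmodType A^c) (x y : V),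
  pp_on ss (cyclic x) -> pp_on ts (cyclic y) -> pp_on rs (bicyclic x y) ->
  pp_on ws (bicyclic x y).
Proof.
move=> dist RS RT V x y Sx Ty Rxy.
have [X [i [iinj iE]]] := embedding_of (cyclic_submodule x).
have [Y [j [jinj jE]]] := embedding_of (cyclic_submodule y).
have [M [l [linj lE]]] := embedding_of (bicyclic_submodule x y).
have [x' x'E] : exists x', i x' = x by apply/iE; exists 1; rewrite ract1.
have [y' y'E] : exists y', j y' = y by apply/jE; exists 1; rewrite ract1.
have Xgen u : exists a, u = x' |> a.
  have [a uE] : cyclic x (i u) by apply/iE; exists u.
  by exists a; apply: iinj; rewrite linear_ract x'E.
have Ygen u : exists a, u = y' |> a.
  have [a uE] : cyclic y (j u) by apply/jE; exists u.
  by exists a; apply: jinj; rewrite linear_ract y'E.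
have fgX : @finitely_generated A X.
  exists 1%N, (fun=> x') => u; have [a ->] := Xgen u; exists (fun=> a).
  by rewrite big_ord1.
have fgY : @finitely_generated A Y.
  exists 1%N, (fun=> y') => u; have [a ->] := Ygen u; exists (fun=> a).
  by rewrite big_ord1.
have /choice[f fE] : forall u : X * Y, exists m, l m = i u.1 + j u.2.
  move=> [u v]; apply/lE; have [a ->] := Xgen u; have [b ->] := Ygen v.
  by exists a, b; rewrite !linear_ract x'E y'E.
have flin : linear (f : (X * Y)%type -> M).
  move=> a u v; apply: linj; rewrite linearP !fE /= !linearP.
  by rewrite scalerDr addrACA.
pose fL := GRing.isLinear.Build A^c (X * Y)%type M _ f flin.
pose F : {linear (X * Y)%type -> M} := HB.pack f fL.
have fs m : exists u, F u = m.
  have [a [b mE]] : bicyclic x y (l m) by apply/lE; exists m.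
  by exists (x' |> a, y' |> b); apply: linj; rewrite fE /= !linear_ract x'E y'E.
have fgM : @finitely_generated A M.
  exists 2%N, (fun k => if k == ord0 then f (x', 0) else f (0, y')) => m.
  have [[u v] <-] := fs m; have [a ->] := Xgen u; have [b ->] := Ygen v.
  exists (fun k => if k == ord0 then a else b).
  rewrite big_ord_recl big_ord1 /=; apply: linj.
  have lZ c w : l (c *: w) = l w |> c by exact: linearZ.
  by rewrite fE linearD !lZ !fE /= !linear0 addr0 add0r !linear_ract.
have := @distributive_le (pp_class rs) (pp_class ss) (pp_class ts) (pp_class ws) dist
  RS RT (Modf fgX) (Modf fgY) (Modf fgM) F fs.
rewrite /= => h; apply/(pp_on_embedding ws linj lE); apply: h.
- exact/(pp_on_embedding ss iinj iE).
- exact/(pp_on_embedding ts jinj jE).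
- exact/(pp_on_embedding rs linj lE).
Qed.
End PPClasses.

(** * Test modules *)

Section Dual.
Variables (k : closedFieldType) (A : falgType k).
Local Notation J := (radical A).
Implicit Types (a b e f r s t n : A).

(* The injective cogenerator of mod A; the test modules are submodules of its powers. *)
Definition dual := 'Hom(A, k^o).
(** Only the additive group is inherited, leaving room for the [A^c]-module structure in place of
    the scaling by [k]. *)
HB.instance Definition _ := GRing.Zmodule.on dual.

Definition dual_scale (a : A^c) (phi : dual) : dual := (phi \o amull a)%VF.
Definition dual_eval (phi : dual) (n : A) : k := (phi : 'Hom(A, k^o)) n.

Lemma dual_evalP (phi psi : dual) : (forall n, dual_eval phi n = dual_eval psi n) -> phi = psi.
Proof. by move=> h; apply/lfunP. Qed.

Lemma dual_evalD phi psi n : dual_eval (phi + psi) n = dual_eval phi n + dual_eval psi n.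
Proof. exact: (add_lfunE (phi : 'Hom(A, k^o)) psi n). Qed.

Lemma dual_scaleE a phi n : dual_eval (dual_scale a phi) n = dual_eval phi (a * n).
Proof. by rewrite /dual_eval comp_lfunE lfunE. Qed.

Lemma dual_scaleA (a b : A^c) phi : dual_scale a (dual_scale b phi) = dual_scale (a * b) phi.
Proof. by apply: dual_evalP => n; rewrite !dual_scaleE mulrA. Qed.

Lemma dual_scale1 : left_id (1 : A^c) dual_scale.
Proof. by move=> phi; apply: dual_evalP => n; rewrite dual_scaleE mul1r. Qed.

Lemma dual_scaleDr : right_distributive dual_scale +%R.
Proof.
by move=> a phi psi; apply: dual_evalP => n; rewrite dual_evalD !dual_scaleE dual_evalD.
Qed.

Lemma dual_evalDr phi m n : dual_eval phi (m + n) = dual_eval phi m + dual_eval phi n.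
Proof. exact: (linearD (phi : 'Hom(A, k^o))). Qed.

Lemma dual_scaleDl phi : {morph dual_scale^~ phi : a b / a + b}.
Proof.
by move=> a b; apply: dual_evalP => n; rewrite dual_evalD !dual_scaleE mulrDl dual_evalDr.
Qed.

HB.instance Definition _ := GRing.Zmodule_isLmodule.Build A^c dual
  dual_scaleA dual_scale1 dual_scaleDr dual_scaleDl.

Lemma dual_ract (phi : dual) a n : dual_eval (phi |> a) n = dual_eval phi (a * n).
Proof. exact: dual_scaleE. Qed.

Lemma dual_evalZ phi (c : k) n : dual_eval phi (c *: n) = c * dual_eval phi n.
Proof. by rewrite /dual_eval linearZ. Qed.

Lemma dual_eval0 n : dual_eval (0 : dual) n = 0.
Proof. exact: (zero_lfunE k^o n). Qed.

Lemma dual_evalBr phi m n : dual_eval phi (m - n) = dual_eval phi m - dual_eval phi n.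
Proof. exact: (linearB (phi : 'Hom(A, k^o))). Qed.

Lemma dual_separates (P : A -> Prop) v : P 0 -> (forall c u w, P u -> P w -> P (c *: u + w)) ->
  ~ P v -> exists2 phi : dual, dual_eval phi v = 1 & forall u, P u -> dual_eval phi u = 0.
Proof. exact: separating_functional. Qed.

Hypothesis dist : pretorsion_lattice_distributive A.

Lemma corner_scalar e r : prim_idem e -> exists c : k, e * r * e - c *: e \in J.
Proof.
move=> pe; have [ee _ _] := pe; apply: scalar_mod_radical => //.
  by rewrite !mulrA ee.
by rewrite -mulrA ee.
Qed.

Lemma pp_kills (X : lmodType A^c) (U : set X) c : pp_on [:: [:: (c, 0)]] U ->
  forall x, U x -> x |> c = 0.
Proof. by move=> [h _] x Ux; have [y _ [-> _]] := h x Ux; rewrite ract0. Qed.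

Lemma pp_killed (X : lmodType A^c) (U : set X) c x : U 0 -> x |> c = 0 ->
  exists2 y, U y & solves [:: (c, 0)] x y.
Proof. by move=> U0 xc; exists 0 => //=; rewrite xc ract0. Qed.

(** [R] exchanges [a] and [b], so within [R] a module killed by one is killed by both. [p1] and [p2]
    generate a module in [R] with [p1 A] killed by [b] and [p2 A] by [a], yet [p1 a] is nonzero. *)
Theorem distributive_no_double_arrow : no_double_arrow A.
Proof.
move=> f a b pf aJ bJ af bf; have [ff _ _] := pf.
apply: contrapT => /not_orP[na nb].
have sep u v : u * f = u -> v * f = v -> ~ (exists r, u - r * v \in (J ^+ 2)%VS) ->
    exists phi : dual, [/\ dual_eval phi u = 1, forall n, dual_eval phi (n * f) = dual_eval phi n,
      forall r, dual_eval phi (r * v) = 0 & forall n, n \in (J ^+ 2)%VS -> dual_eval phi n = 0].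
  move=> uf vf nu.
  have [|||phi phiu phi0] := @dual_separates (fun n => exists r, n * f - r * v \in (J ^+ 2)%VS) u.
  - by exists 0; rewrite !mul0r subrr mem0v.
  - move=> c n m [r hr] [s hs]; exists (c *: r + s).
    by rewrite !mulrDl -!scalerAl opprD addrACA -scalerBr memvD // memvZ.
  - by rewrite uf.
  exists phi; split=> // [n|r|n nJ].
  - apply/eqP; rewrite -subr_eq0 -dual_evalBr phi0 //; exists 0.
    by rewrite mulrBl -mulrA ff subrr mul0r subrr mem0v.
  - by apply: phi0; exists r; rewrite -mulrA vf subrr mem0v.
  - by apply: phi0; exists 0; rewrite mul0r subr0 radicalX_mulr.
have [p1 [p1a p1f p1b p1J]] := sep a b af bf na.
have [p2 [p2b p2f p2a p2J]] := sep b a bf af nb.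
have act phi m r n c : (forall n, dual_eval phi (n * f) = dual_eval phi n) ->
    (forall n, n \in (J ^+ 2)%VS -> dual_eval phi n = 0) -> m \in J -> m * f = m ->
    f * n * f - c *: f \in J -> dual_eval phi (r * (m * n)) = c * dual_eval phi (r * m).
  move=> phif phiJ mJ mf cJ.
  have E : r * (m * n) * f - c *: (r * m) = r * m * (f * n * f - c *: f).
    by rewrite mulrBr -scalerAr -(mulrA r m f) mf -{1}mf !mulrA.
  rewrite -phif -dual_evalZ; apply/eqP; rewrite -subr_eq0 -dual_evalBr E phiJ //.
  by rewrite -mulrA radicalX_mull // expv2 memv_mul.
have bic (r s : A) : bicyclic p1 p2 (p1 |> r + p2 |> s) by exists r, s.
have p1b0 r : p1 |> r |> b = 0.
  apply: dual_evalP => n; have [c cJ] := corner_scalar n pf.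
  by rewrite !dual_ract (act p1 b r n c) // p1b mulr0 dual_eval0.
have p2a0 r : p2 |> r |> a = 0.
  apply: dual_evalP => n; have [c cJ] := corner_scalar n pf.
  by rewrite !dual_ract (act p2 a r n c) // p2a mulr0 dual_eval0.
have p1a2 r : p1 |> r |> a = p2 |> (dual_eval p1 (r * a) *: 1) |> b.
  apply: dual_evalP => n; have [c cJ] := corner_scalar n pf.
  rewrite !dual_ract (act p1 a r n c) // -scalerAl mul1r dual_evalZ.
  by rewrite -[b * n]mul1r (act p2 b 1 n c) // mul1r p2b mulr1 mulrC.
have p2b1 r : p2 |> r |> b = p1 |> (dual_eval p2 (r * b) *: 1) |> a.
  apply: dual_evalP => n; have [c cJ] := corner_scalar n pf.
  rewrite !dual_ract (act p2 b r n c) // -scalerAl mul1r dual_evalZ.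
  by rewrite -[a * n]mul1r (act p1 a 1 n c) // mul1r p1a mulr1 mulrC.
have [] : pp_on [:: [:: (a, 0)]; [:: (b, 0)]] (bicyclic p1 p2).
  apply: (distributive_pp (rs := [:: [:: (a, b)]; [:: (b, a)]]) (ss := [:: [:: (b, 0)]])
    (ts := [:: [:: (a, 0)]]) dist).
  - move=> X [h1 [h2 _]] /pp_kills xb /=; split=> [x _|]; last first.
      by split=> // x _; apply: (@pp_killed _ setT) => //; apply: xb.
    by apply: (@pp_killed _ setT) => //; have [y _ [-> _]] := h1 x I; apply: xb.
  - move=> X [h1 [h2 _]] /pp_kills xa /=; split=> [x _|].
      by apply: (@pp_killed _ setT) => //; apply: xa.
    split=> // x _; apply: (@pp_killed _ setT) => //.
    by have [y _ [-> _]] := h2 x I; apply: xa.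
  - split=> // _ [r ->]; apply: pp_killed => //; first by exists 0; rewrite ract0.
  - split=> // _ [r ->]; apply: pp_killed => //; first by exists 0; rewrite ract0.
  split; last split=> //; move=> _ [r [s ->]].
    exists (p1 |> 0 + p2 |> (dual_eval p1 (r * a) *: 1)) => //.
    by split=> //=; rewrite !ractDl p2a0 p1b0 p1a2 addr0 add0r.
  exists (p1 |> (dual_eval p2 (s * b) *: 1) + p2 |> 0) => //.
  by split=> //=; rewrite !ractDl p2a0 p1b0 p2b1 addr0 add0r.
move=> h _; have [|y _ [p1a0 _]] := h p1.
  by have := bic 1 0; rewrite ract1 ract0 addr0.
have := congr1 (fun phi => dual_eval phi 1) p1a0.
rewrite /= ract0 dual_ract mulr1 p1a dual_eval0 => /eqP.
by rewrite oner_eq0.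
Qed.

(** The second property says [phi |> e = phi], so [phi] generates a quotient of [e A]. *)
Lemma corner_functional e (P : A -> Prop) v : prim_idem e -> e * v = v -> P 0 ->
  (forall c u w, P u -> P w -> P (c *: u + w)) -> ~ P v ->
  exists phi : dual, [/\ dual_eval phi v = 1, forall n, dual_eval phi (e * n) = dual_eval phi n
    & forall u, P (e * u) -> dual_eval phi u = 0].
Proof.
move=> [ee _ _] ev P0 PL nPv.
have [|||phi phiv phi0] := @dual_separates (fun n => P (e * n)) v.
- by rewrite mulr0.
- by move=> c u w Pu Pw; rewrite mulrDr -scalerAr; apply: PL.
- by rewrite ev.
exists phi; split=> // n; apply/eqP; rewrite -subr_eq0 -dual_evalBr phi0 //.
by rewrite mulrBr mulrA ee subrr.
Qed.

(* phi(r v n) only depends on the scalar part of e r e, provided that phi kills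
   (e J e) v A. *)
Lemma corner_eval e (phi : dual) v r c n : e * v = v -> e * r * e - c *: e \in J ->
  (forall n, dual_eval phi (e * n) = dual_eval phi n) ->
  (forall j, j \in J -> dual_eval phi (j * v * n) = 0) ->
  dual_eval phi (r * v * n) = c * dual_eval phi (v * n).
Proof.
move=> ev cJ phie phiJ; rewrite -phie -dual_evalZ; apply/eqP.
rewrite -subr_eq0 -dual_evalBr (_ : _ - _ = (e * r * e - c *: e) * v * n) ?phiJ //.
by rewrite !mulrBl -!scalerAl ev -(mulrA (e * r)) ev !mulrA.
Qed.

(** Let [c'] and [c] be the scalar parts of [r] and [s]. On [x1 r + x2 s] the elements [a1], [a2],
    [a3] are detected by [c], [c'], [c + c'] in the three coordinates. [R] only asks [a3] to vanish
    on the solution, so opposite scalars solve it; [W] asks the same of [a1] or [a2] as well,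
    forcing both scalars to be 0. *)
Theorem distributive_no_three_socle : no_three_socle A.
Proof.
move=> e a1 a2 a3 m m' m'm pe ea1 ea2 ea3 rad [N1 N2 N3]; have [ee _ _] := pe.
have radn n : n \in J -> n * a1 \in (J ^+ m.+1)%VS /\ n * a2 \in (J ^+ m.+1)%VS.
  by case/rad.
have rad' n : n \in J -> [/\ n * a1 \in (J ^+ m'.+1)%VS, n * a2 \in (J ^+ m'.+1)%VS &
                            n * a3 \in (J ^+ m'.+1)%VS].
  by move=> /rad[r1 r2 r3]; split=> //; apply: (subvP (radicalXS A m'm)).
have sep l u v w : e * u = u -> e * v = v -> e * w = w ->
    (forall p q, u - (v * p + w * q) \notin (J ^+ l.+1)%VS) ->
    exists phi : dual, [/\ dual_eval phi u = 1, forall n, dual_eval phi (e * n) = dual_eval phi n,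
      forall n, dual_eval phi (v * n) = 0, forall n, dual_eval phi (w * n) = 0 &
      forall n, n \in (J ^+ l.+1)%VS -> dual_eval phi n = 0].
  move=> eu ev ew nu.
  have [|||phi [phiu phie phi0]] := @corner_functional e
    (fun n => exists p q, n - (v * p + w * q) \in (J ^+ l.+1)%VS) u pe eu.
  - by exists 0, 0; rewrite !mulr0 addr0 subr0 mem0v.
  - move=> c x y [p [q h]] [p' [q' h']]; exists (c *: p + p'), (c *: q + q').
    rewrite !mulrDr -!scalerAr (addrACA (c *: _)) -scalerDr opprD addrACA -scalerBr.
    by rewrite memvD // memvZ.
  - by move=> [p [q h]]; case/negP: (nu p q).
  exists phi; split=> // n; [| |move=> nJ]; apply: phi0.
  - by exists n, 0; rewrite mulr0 addr0 mulrA ev subrr mem0v.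
  - by exists 0, n; rewrite mulr0 add0r mulrA ew subrr mem0v.
  - by exists 0, 0; rewrite !mulr0 addr0 subr0 radicalX_mull.
have [p1 [p11 p1e p12 p13 p1J]] := sep m a1 a2 a3 ea1 ea2 ea3 N1.
have [p2 [p22 p2e p21 p23 p2J]] := sep m a2 a1 a3 ea2 ea1 ea3 N2.
have [p3 [p33 p3e p31 p32 p3J]] := sep m' a3 a1 a2 ea3 ea1 ea2 N3.
pose V : lmodType A^c := (dual * dual * dual)%type.
pose x1 : V := (0, p2, p3); pose x2 : V := (p1, 0, p3).
have Vext (u v : V) : (forall n, [/\ dual_eval u.1.1 n = dual_eval v.1.1 n,
    dual_eval u.1.2 n = dual_eval v.1.2 n & dual_eval u.2 n = dual_eval v.2 n]) -> u = v.
  case: u v => [[u1 u2] u3] [[v1 v2] v3] /= h.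
  by congr (_, _, _); apply: dual_evalP => n; have [] := h n.
have elt r s : x1 |> r + x2 |> s = (p1 |> s, p2 |> r, p3 |> (r + s)).
  rewrite (_ : _ + _ = (0 |> r + p1 |> s, p2 |> r + 0 |> s, p3 |> r + p3 |> s)) //.
  by rewrite !ract0l add0r addr0 -ractDr.
have V0 : (0 : V) = (0, 0, 0) by [].
have Vract (u v w : dual) a : ((u, v, w) : V) |> a = (u |> a, v |> a, w |> a) by [].
have x1r r : x1 |> r = (0, p2 |> r, p3 |> r) by rewrite /x1 Vract ract0l.
have x2r r : x2 |> r = (p1 |> r, 0, p3 |> r) by rewrite /x2 Vract ract0l.
have ev1 r c v n : e * r * e - c *: e \in J -> v \in [:: a1; a2] ->
    dual_eval p1 (r * v * n) = c * dual_eval p1 (v * n).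
  move=> cJ va; apply: (corner_eval _ cJ p1e).
    by move: va; rewrite !inE => /orP[] /eqP ->.
  move=> j jJ; apply: p1J; apply: radicalX_mulr; have [h1 h2] := radn j jJ.
  by move: va; rewrite !inE => /orP[] /eqP ->.
have ev2 r c v n : e * r * e - c *: e \in J -> v \in [:: a1; a2] ->
    dual_eval p2 (r * v * n) = c * dual_eval p2 (v * n).
  move=> cJ va; apply: (corner_eval _ cJ p2e).
    by move: va; rewrite !inE => /orP[] /eqP ->.
  move=> j jJ; apply: p2J; apply: radicalX_mulr; have [h1 h2] := radn j jJ.
  by move: va; rewrite !inE => /orP[] /eqP ->.
have ev3 r c v n : e * r * e - c *: e \in J -> v \in [:: a1; a2; a3] ->
    dual_eval p3 (r * v * n) = c * dual_eval p3 (v * n).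
  move=> cJ va; apply: (corner_eval _ cJ p3e).
    by move: va; rewrite !inE => /or3P[] /eqP ->.
  move=> j jJ; apply: p3J; apply: radicalX_mulr; have [h1 h2 h3] := rad' j jJ.
  by move: va; rewrite !inE => /or3P[] /eqP ->.
have scaled (phi : dual) c v n : dual_eval (phi |> (c *: 1) |> v) n = c * dual_eval phi (v * n).
  by rewrite !dual_ract -scalerAl mul1r dual_evalZ.
have p1s r c : e * r * e - c *: e \in J -> p1 |> r |> a1 = p1 |> (c *: 1) |> a1 /\ p1 |> r |> a2 = 0.
  move=> cJ; split; apply: dual_evalP => n; rewrite ?scaled !dual_ract mulrA.
    by rewrite (ev1 r c) ?inE ?eqxx.
  by rewrite (ev1 r c) ?inE ?eqxx ?orbT // p12 mulr0 dual_eval0.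
have p2s r c : e * r * e - c *: e \in J -> p2 |> r |> a2 = p2 |> (c *: 1) |> a2 /\ p2 |> r |> a1 = 0.
  move=> cJ; split; apply: dual_evalP => n; rewrite ?scaled !dual_ract mulrA.
    by rewrite (ev2 r c) ?inE ?eqxx ?orbT.
  by rewrite (ev2 r c) ?inE ?eqxx // p21 mulr0 dual_eval0.
have p3s r c : e * r * e - c *: e \in J ->
    [/\ p3 |> r |> a1 = 0, p3 |> r |> a2 = 0 & p3 |> r |> a3 = p3 |> (c *: 1) |> a3].
  move=> cJ; split; apply: dual_evalP => n; rewrite ?scaled !dual_ract mulrA (ev3 r c) ?inE ?eqxx ?orbT //.
    by rewrite p31 mulr0 dual_eval0.
  by rewrite p32 mulr0 dual_eval0.
have p1c c : p1 |> (c *: 1) |> a3 = 0.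
  by apply: dual_evalP => n; rewrite scaled p13 mulr0 dual_eval0.
have p2c c : p2 |> (c *: 1) |> a3 = 0.
  by apply: dual_evalP => n; rewrite scaled p23 mulr0 dual_eval0.
have scJ c : e * (c *: 1) * e - c *: e \in J.
  by rewrite -scalerAr mulr1 -scalerAl ee subrr mem0v.
have kill1 r : x1 |> r |> a1 = 0.
  have [c cJ] := corner_scalar r pe.
  have [_ h2] := p2s r c cJ; have [h3 _ _] := p3s r c cJ.
  by rewrite x1r Vract h2 h3 !ract0l.
have kill2 s : x2 |> s |> a2 = 0.
  have [c cJ] := corner_scalar s pe.
  have [_ h1] := p1s s c cJ; have [_ h3 _] := p3s s c cJ.
  by rewrite x2r Vract h1 h3 !ract0l.
have V00 (U : set V) z : submodule U -> z = 0 -> U z by move=> sU ->; exact: submodule0.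
have [h _] : pp_on [:: [:: (a1, a1); (0, a2); (0, a3)]; [:: (a2, a2); (0, a1); (0, a3)]] (bicyclic x1 x2).
  apply: (distributive_pp (rs := [:: [:: (a1, a1); (0, a3)]; [:: (a2, a2); (0, a3)]])
    (ss := [:: [:: (a1, 0)]]) (ts := [:: [:: (a2, 0)]]) dist).
  - move=> X [h1 [h2 _]] /pp_kills xa /=; split=> [x _|].
      by exists 0 => //; rewrite !ract0l xa // !ract0.
    split=> // x _; have [y _ [ya [yb _]]] := h2 x I; exists y => //.
    by split=> //; split=> //; rewrite xa // ract0.
  - move=> X [h1 [h2 _]] /pp_kills xa /=; split=> [x _|].
      have [y _ [ya [yb _]]] := h1 x I; exists y => //.
      by split=> //; split=> //; rewrite xa // ract0.
    by split=> // x _; exists 0 => //; rewrite !ract0l xa // !ract0.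
  - split=> // _ [r ->]; apply: pp_killed; last exact: kill1.
    by exists 0; rewrite ract0.
  - split=> // _ [r ->]; apply: pp_killed; last exact: kill2.
    by exists 0; rewrite ract0.
  split; last split=> //; move=> _ [r [s ->]].
    have [c cJ] := corner_scalar s pe; have [c' cJ'] := corner_scalar r pe.
    have [E1 _] := p1s s c cJ; have [_ E2] := p2s r c' cJ'.
    have [_ E2'] := p2s _ _ (scJ (- c)).
    have [d dJ] := corner_scalar (r + s) pe.
    have [E3 _ _] := p3s (r + s) d dJ.
    exists (x1 |> (- c *: 1) + x2 |> (c *: 1)); first by exists (- c *: 1), (c *: 1).
    by rewrite /= !elt scaleNr addNr ract0 !Vract E1 E2 E3 p1c -scaleNr E2' p2c !ract0l !ract0.
  have [c cJ] := corner_scalar s pe; have [c' cJ'] := corner_scalar r pe.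
  have [_ E1] := p1s s c cJ; have [E2 _] := p2s r c' cJ'.
  have [_ E1'] := p1s _ _ (scJ (- c')).
  have [d dJ] := corner_scalar (r + s) pe.
  have [_ E3 _] := p3s (r + s) d dJ.
  exists (x1 |> (c' *: 1) + x2 |> (- c' *: 1)); first by exists (c' *: 1), (- c' *: 1).
  by rewrite /= !elt scaleNr addrN ract0 !Vract E1 E2 E3 -scaleNr E1' p1c p2c !ract0l !ract0.
have [|_ [r [s ->]] [ya1 [ya2 [ya3 _]]]] := h (x1 |> 0 + x2 |> 1); first by exists 0, 1.
have [c cJ] := corner_scalar s pe; have [c' cJ'] := corner_scalar r pe.
have rsJ : e * (r + s) * e - (c' + c) *: e \in J.
  by rewrite mulrDr mulrDl scalerDl opprD addrACA memvD.
have [E1 _] := p1s s c cJ; have [E2 _] := p2s r c' cJ'; have [_ _ E3] := p3s (r + s) _ rsJ.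
have at1 (phi psi : dual) : phi = psi -> dual_eval phi 1 = dual_eval psi 1 by move=> ->.
move: ya2; rewrite /= !elt !Vract E2 !ract0 => -[_ /at1 c'0 _].
move: c'0; rewrite scaled mulr1 p22 mulr1 dual_eval0 => /esym c'0.
move: ya3; rewrite /= !elt !Vract E3 !ract0 => -[_ _ /at1 c0].
move: c0; rewrite scaled mulr1 p33 mulr1 dual_eval0 => /esym; rewrite c'0 add0r => c0.
move: ya1; rewrite /= !elt !Vract E1 => -[/at1].
rewrite scaled c0 mul0r dual_ract dual_ract mul1r mulr1 p11 => /eqP.
by rewrite oner_eq0.
Qed.

(** [x1 z b = x2 b], and [x2 A] is killed by [c]. [R] asks for [x z c = y c] with [y b = 0], which
    multiples of [x1 z - x2] solve. If moreover [y f = u z], as [S] provides, then [u] solves [W];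
    if [c] kills everything, 0 does. In the sum, [u z b = 0] makes the scalar part of [u] on [x1]
    zero, while [x1 z c] is nonzero. *)
Theorem distributive_no_branching : no_branching A.
Proof.
move=> e f z b c pe pf zJ ez zf ezf bJ cJ fb fc [Nb Nc].
have [ee _ _] := pe; have [ff _ _] := pf.
have sep u v : (forall p, z * u - z * v * p \notin (J ^+ 3)%VS) ->
    exists phi : dual, [/\ dual_eval phi (z * u) = 1, forall n, dual_eval phi (e * n) = dual_eval phi n,
      forall n, dual_eval phi (z * v * n) = 0 & forall n, n \in (J ^+ 3)%VS -> dual_eval phi n = 0].
  move=> nu.
  have [||||phi [phiu phie phi0]] := @corner_functional e
    (fun n => exists p, n - z * v * p \in (J ^+ 3)%VS) (z * u) pe.
  - by rewrite mulrA ez.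
  - by exists 0; rewrite mulr0 subr0 mem0v.
  - move=> d x y [p h] [p' h']; exists (d *: p + p').
    by rewrite mulrDr -scalerAr opprD addrACA -scalerBr memvD // memvZ.
  - by move=> [p h]; case/negP: (nu p).
  exists phi; split=> // n; [|move=> nJ]; apply: phi0.
  - by exists n; rewrite !mulrA ez subrr mem0v.
  - by exists 0; rewrite mulr0 subr0 radicalX_mull.
have [p [pzb pE pzc pJ]] := sep b c Nb; have [q [qzc qE qzb qJ]] := sep c b Nc.
pose V : lmodType A^c := (dual * dual)%type.
pose x1 : V := (p, q); pose x2 : V := (p |> z, 0).
have J3 j v : j \in J -> v \in J -> j * (z * v) \in (J ^+ 3)%VS.
  by move=> jJ vJ; rewrite expvSl expv2 !memv_mul.
have ev (phi : dual) r d v n : (forall n, dual_eval phi (e * n) = dual_eval phi n) ->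
    (forall n, n \in (J ^+ 3)%VS -> dual_eval phi n = 0) -> v \in J ->
    e * r * e - d *: e \in J -> dual_eval phi (r * (z * v * n)) = d * dual_eval phi (z * v * n).
  move=> phie phiJ vJ dJ; rewrite mulrA; apply: (corner_eval _ dJ phie); first by rewrite mulrA ez.
  by move=> j jJ; apply: phiJ; apply: radicalX_mulr; apply: J3.
have scaled (phi : dual) d v n : dual_eval (phi |> (d *: 1) |> v) n = d * dual_eval phi (v * n).
  by rewrite !dual_ract -scalerAl mul1r dual_evalZ.
have evz (phi : dual) r d v : (forall n, dual_eval phi (e * n) = dual_eval phi n) ->
    (forall n, n \in (J ^+ 3)%VS -> dual_eval phi n = 0) -> v \in J ->
    e * r * e - d *: e \in J -> phi |> r |> (z * v) = phi |> (d *: 1) |> (z * v).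
  by move=> phie phiJ vJ dJ; apply: dual_evalP => n; rewrite scaled !dual_ract; apply: ev.
have kz (phi : dual) v d : (forall n, dual_eval phi (z * v * n) = 0) ->
    phi |> (d *: 1) |> (z * v) = 0.
  by move=> phi0; apply: dual_evalP => n; rewrite scaled phi0 mulr0 dual_eval0.
have kzz s v : v \in J -> p |> z |> s |> (z * v) = 0.
  move=> vJ; apply: dual_evalP => n; rewrite !dual_ract dual_eval0; apply: pJ.
  by rewrite !mulrA -2!(mulrA (z * s)) mulrA radicalX_mulr // J3 // radical_mulr.
have kzc s : p |> z |> s |> c = 0.
  apply: dual_evalP => n; rewrite !dual_ract dual_eval0.
  have [d dJ] := corner_scalar s pf.
  have -> : z * (s * (c * n)) = z * (f * s * f - d *: f) * c * n + z * c * (d *: n).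
    rewrite mulrBr -!scalerAr zf !mulrBl -!scalerAl scalerAr !mulrA zf -(mulrA _ f c) fc.
    by rewrite -scalerAr subrK.
  rewrite dual_evalDr pzc addr0; apply: pJ; apply: radicalX_mulr.
  by rewrite -mulrA expvSl expv2 !memv_mul.
have Vract (u v : dual) a : ((u, v) : V) |> a = (u |> a, v |> a) by [].
have x1r r : x1 |> r = (p |> r, q |> r) by rewrite /x1 Vract.
have x2r r : x2 |> r = (p |> z |> r, 0) by rewrite /x2 Vract ract0l.
have elt r s : x1 |> r + x2 |> s = (p |> r + p |> z |> s, q |> r).
  by rewrite x1r x2r -[in RHS](addr0 (q |> r)).
have [h _] : pp_on [:: [:: (z * c, z * c); (0, z * b)]] (bicyclic x1 x2).
  apply: (distributive_pp (rs := [:: [:: (z * c, c); (0, b)]]) (ss := [:: [:: (f, z)]])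
    (ts := [:: [:: (c, 0)]]) dist).
  - move=> X [h1 _] [h2 _] /=; split=> // x _.
    have [y _ [yc [yb _]]] := h1 x I; have [u _ [uz _]] := h2 y I; exists u => //.
    by rewrite (ractM u z c) (ractM u z b) -uz -!(ractM y) fb fc.
  - move=> X _ /pp_kills xc /=; split=> // x _; exists 0 => //.
    by rewrite !ractM xc // !ract0l !ract0.
  - split=> // _ [r ->]; have [t tE] := ezf r.
    exists (x1 |> t); first by exists t.
    split=> //=; rewrite !x1r !Vract; congr (_, _); apply: dual_evalP => n; rewrite !dual_ract.
      by rewrite -pE !mulrA tE.
    by rewrite -qE !mulrA tE.
  - split=> // _ [r ->]; apply: pp_killed; last by rewrite x2r Vract kzc ract0l.
    by exists 0; rewrite ract0.
  split=> // _ [r [s ->]]; have [d dJ] := corner_scalar r pe.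
  exists (x1 |> (d *: z) + x2 |> (- d *: 1)); first by exists (d *: z), (- d *: 1).
  have pz0 : p |> (d *: z) + p |> z |> (- d *: 1) = 0.
    apply: dual_evalP => n; rewrite dual_evalD !dual_ract dual_eval0 -scalerAl dual_evalZ.
    by rewrite -scalerAl mul1r -scalerAr dual_evalZ mulNr addrN.
  rewrite /= !elt pz0 !Vract !ractDl !ract0l kzz // (evz p r d) // (evz q r d) //.
  have qz v : q |> (d *: z) |> v = q |> (d *: 1) |> (z * v).
    by rewrite -!ractM -!scalerAl mul1r.
  by rewrite !qz (kz p c) // (kz q b) // !ract0 !addr0.
have [|_ [r [s ->]] [Ec [Eb _]]] := h (x1 |> 1 + x2 |> 0); first by exists 1, 0.
have [d dJ] := corner_scalar r pe.
have at1 (phi psi : dual) : phi = psi -> dual_eval phi 1 = dual_eval psi 1 by move=> ->.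
move: Eb; rewrite /= !elt !Vract !ractDl kzz // (evz p r d) // !ract0 !addr0 => -[/at1 + _].
rewrite scaled mulr1 pzb mulr1 dual_eval0 => /esym d0.
move: Ec; rewrite /= !elt !Vract (evz q r d) // => -[_ /at1].
rewrite scaled d0 mul0r !dual_ract mul1r mulr1 qzc => /eqP.
by rewrite oner_eq0.
Qed.
End Dual.

(** * The two implications *)

Section LocalModules.
Variables (k : closedFieldType) (A : falgType k).
Local Notation J := (radical A).

(** The maximal submodule is [x J]: it misses [x] by nilpotency, and [x a] with [e a] outside [J]
    generates [x]. *)
Lemma cyclic_unique_maximal (M : lmodType A^c) (e : A) (x : M) : prim_idem e ->
  x |> e = x -> x <> 0 -> cyclic x = setT -> exists! U : set M, maximal_submodule U.
Proof.
move=> pe xe x0 xT; have [ee _ _] := pe.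
have gen m : exists a, m = x |> a by have : cyclic x m by rewrite xT.
pose U : set M := [set m | exists2 a, a \in J & m = x |> a].
have sU : submodule U.
  apply/submoduleP; split=> [|a _ _ [b bJ ->] [c cJ ->]].
    by exists 0; rewrite ?mem0v ?ract0.
  by exists (b * a + c); rewrite ?memvD ?radical_mulr // ractDr ractM.
have nUx : ~ U x.
  move=> [a aJ xa]; have [n an] := radical_nil aJ; apply: x0.
  have -> : x = x |> a ^+ n by elim: n {an} => [|n IHn]; rewrite ?expr0 ?ract1 // exprS ractM -xa.
  by rewrite an ract0.
have proper V : submodule V -> V <> setT -> V `<=` U.
  move=> sV nV v Vv; have [a va] := gen v; apply: contrapT => nU; apply: nV.
  have na : e * a \notin J.
    by apply/negP => aJ; apply: nU; exists (e * a); rewrite // ractM xe.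
  have [|r rE] := right_inv pe _ na; first by rewrite mulrA ee.
  have Vx : V x by rewrite -xe -rE !ractM xe -va; apply: submodule_ract.
  by apply/seteqP; split=> // m _; have [b ->] := gen m; apply: submodule_ract.
have nU : U <> setT by move=> UT; apply: nUx; rewrite UT.
exists U; split.
  split=> // V sV UV nV; apply/seteqP; split=> //; exact: proper.
move=> V [sV nV maxV]; apply: maxV => //; exact: proper.
Qed.

Theorem distributive_local : pretorsion_lattice_distributive A ->
  forall M : modf A, indecomposable M -> exists! U : set M, maximal_submodule U.
Proof.
move=> dist M [[m0 m0N] indM].
have LS := no_double_arrow_serial (distributive_no_double_arrow dist).
have AR := arms_ex LS (distributive_no_three_socle dist) (distributive_no_branching dist).
have [I [x [e [xe span indep]]]] := local_decomposition_ex LS AR (modf_fg M).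
have [i xi0] : exists i, x i <> 0.
  apply: contra_notP m0N => h; have [a ->] := span m0; apply: big1 => i _.
  have -> : x i = 0 by apply: contrapT => xi; apply: h; exists i.
  by rewrite ract0l.
have [pe xie] := xe i; apply: (cyclic_unique_maximal pe xie xi0).
pose V : set M := [set v | exists a : I -> A, v = \sum_(j | j != i) x j |> a j].
have sV : submodule V.
  apply/submoduleP; split=> [|a _ _ [b ->] [c ->]].
    by exists (fun=> 0); rewrite big1 // => j _; rewrite ract0.
  exists (fun j => b j * a + c j); rewrite ract_suml -big_split /=.
  by apply: eq_bigr => j _; rewrite ractDr ractM.
have sumD (a : A) (b : I -> A) : \sum_j x j |> (if j == i then a else b j) =
    x i |> a + \sum_(j | j != i) x j |> b j.
  by rewrite (bigD1 i) //= eqxx; congr (_ + _); apply: eq_bigr => j /negPf->.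
have [|U0|V0] := indM (cyclic (x i)) V.
- split=> //; first exact: cyclic_submodule.
    apply/seteqP; split=> [v [[a va] [b vb]]|_ ->]; last first.
      by split; [exact: (submodule0 (cyclic_submodule _))|exact: submodule0].
    have negE : \sum_(j | j != i) x j |> (- b j) = - v.
      by rewrite vb -sumrN; apply: eq_bigr => j _; rewrite ractNr.
    have := indep (fun j => if j == i then a else - b j).
    by rewrite sumD negE -va subrr => /(_ erefl i); rewrite eqxx -va.
  move=> m; have [a mE] := span m; exists (x i |> a i); first by exists (a i).
  exists (\sum_(j | j != i) x j |> a j); first by exists a.
  by rewrite mE (bigD1 i).
- have : cyclic (x i) (x i) by exists 1; rewrite ract1.
  by rewrite U0.
apply/seteqP; split=> // m _; have [a mE] := span m; exists (a i).
have : V (\sum_(j | j != i) x j |> a j) by exists a.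
by rewrite V0 => v0; rewrite mE (bigD1 i) //= v0 addr0.
Qed.
End LocalModules.

(** * From local indecomposable modules to distributivity *)

Section Converse.
Variables (k : fieldType) (A : falgType k).

Lemma maximal_submodule_above (M : modf A) (V : set M) : submodule V -> V <> setT ->
  exists2 W, maximal_submodule W & V `<=` W.
Proof.
have [d [N [dN dlt]]] := fg_rank (modf_fg M).
have [c] := ubnP (N - d V); elim: c V => // c IHc V ltc sV nV.
have [mV|nmV] := pselect (maximal_submodule V); first by exists V.
have [V' [sV' VV' nV' neV]] : exists V', [/\ submodule V', V `<=` V', V' <> setT & V' <> V].
  apply: contra_notP nmV => h; split=> // V' sV' VV' nV'.
  by apply: contrapT => ne; apply: h; exists V'.
have ltd : (d V < d V')%N.
  by apply: dlt => // V'V; apply: neV; apply/seteqP.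
have [|//|//|W mW V'W] := IHc V'.
  by rewrite -ltnS (leq_trans _ ltc) // ltnS ltn_sub2l // (leq_trans ltd).
by exists W => // v /VV' /V'W.
Qed.

(** The form in which a unique maximal submodule gets used: it applies to the images of the two
    factors of a direct sum. *)
Definition hollow (M : lmodType A^c) := forall U V : set M, submodule U -> submodule V ->
  (forall x, exists2 u, U u & exists2 v, V v & x = u + v) -> U = setT \/ V = setT.

Lemma unique_maximal_hollow (M : modf A) :
  (exists! U : set M, maximal_submodule U) -> hollow M.
Proof.
move=> [W [[sW nW _] uW]] U V sU sV UV.
apply: contrapT => /not_orP[nU nV]; apply: nW.
have [W1 mW1 UW1] := maximal_submodule_above sU nU.
have [W2 mW2 VW2] := maximal_submodule_above sV nV.
apply/seteqP; split=> // x _; have [u Uu [v Vv ->]] := UV x.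
by apply: submoduleD => //; [rewrite (uW _ mW1); apply: UW1|rewrite (uW _ mW2); apply: VW2].
Qed.

(* The class of the modules all of whose nonzero hollow quotients lie in S or
   in T contains S and T, hence their join. *)
Section HollowQuotients.
Variables S T : pretorsion_class A.

Definition hollow_quotients (Y : modf A) := forall (X : modf A) (g : {linear Y -> X}),
  (forall x, exists y, g y = x) -> hollow X -> (exists x : X, x <> 0) -> S X \/ T X.

Lemma hollow_quotients_quotient (M N : modf A) (f : {linear M -> N}) :
  (forall y, exists x, f x = y) -> hollow_quotients M -> hollow_quotients N.
Proof.
move=> fs PM X g gs; apply: (PM X (g \o f)) => x.
by have [y <-] := gs x; have [m <-] := fs y; exists m.
Qed.

Lemma hollow_quotients_iso (M N : modf A) (f : {linear M -> N}) :
  bijective f -> hollow_quotients M -> hollow_quotients N.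
Proof. by move=> [g _ fg]; apply: hollow_quotients_quotient => y; exists (g y). Qed.

Lemma hollow_quotients0 (M : modf A) : (forall x : M, x = 0) -> hollow_quotients M.
Proof. by move=> M0 X g gs _ [x []]; have [y <-] := gs x; rewrite (M0 y) linear0. Qed.

Lemma hollow_quotients_sum (M N : modf A) :
  hollow_quotients M -> hollow_quotients N -> hollow_quotients (modf_prod M N).
Proof.
move=> PM PN X g gs hX X0.
have lin1 : linear (fun y : M => g (y, 0)).
  by move=> a u v; rewrite -linearP /=; congr (g _); congr pair; rewrite /= scaler0 addr0.
have lin2 : linear (fun y : N => g (0, y)).
  by move=> a u v; rewrite -linearP /=; congr (g _); congr pair; rewrite /= scaler0 addr0.
pose L1 := GRing.isLinear.Build _ _ _ _ _ lin1.
pose g1 : {linear M -> X} := HB.pack (fun y : M => g (y, 0)) L1.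
pose L2 := GRing.isLinear.Build _ _ _ _ _ lin2.
pose g2 : {linear N -> X} := HB.pack (fun y : N => g (0, y)) L2.
have range_sub (Y : lmodType A^c) (f : {linear Y -> X}) : submodule (range f).
  apply/submoduleP; split=> [|a _ _ [u _ <-] [v _ <-]]; first by exists 0; rewrite ?linear0.
  by exists (u |> a + v); rewrite // linearD linear_ract.
have [|g1T|g2T] := hX (range g1) (range g2) (range_sub _ _) (range_sub _ _).
- move=> x; have [[u v] <-] := gs x; exists (g (u, 0)); first by exists u.
  exists (g (0, v)); first by exists v.
  by rewrite -linearD /=; congr (g _); congr pair; rewrite /= ?addr0 ?add0r.
- apply: (PM X g1) => // x; have [y _ <-] : range g1 x by rewrite g1T.
  by exists y.
- apply: (PN X g2) => // x; have [y _ <-] : range g2 x by rewrite g2T.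
  by exists y.
Qed.

Definition hollow_quotient_class : pretorsion_class A :=
  PretorsionClass hollow_quotients_iso hollow_quotients0 hollow_quotients_quotient
    hollow_quotients_sum.

Lemma hollow_join (X : modf A) : hollow X ->
  (exists x : X, x <> 0) -> pretorsion_join S T X -> S X \/ T X.
Proof.
move=> hX X0 /(_ hollow_quotient_class) h.
have {}h : hollow_quotients X.
  apply: h => N ST Y g gs _ _.
  by case: ST => [SN|TN]; [left|right]; exact: pretorsion_quotient gs _.
by apply: (h X (@idfun X : {linear X -> X})) => // x; exists x.
Qed.
End HollowQuotients.

Lemma fg_image (M N : lmodType A^c) (f : {linear M -> N}) : (forall y, exists x, f x = y) ->
  finitely_generated M -> finitely_generated N.
Proof.
move=> fs [n [g gP]]; exists n, (f \o g) => y; have [x <-] := fs y.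
have [a ->] := gP x; exists a; rewrite linear_sum; apply: eq_bigr => i _.
exact: linearZ.
Qed.

(** The projections make the summands quotients of [X], which gives their finite generation and
    keeps them in every pretorsion class containing [X]. *)
Lemma direct_decomposition_modules (X : modf A) (U V : set X) : direct_decomposition U V ->
  exists (Y Z : modf A) (i : {linear Y -> X}) (j : {linear Z -> X}) (p : {linear X -> Y})
    (q : {linear X -> Z}),
  [/\ injective i /\ injective j, forall x, U x <-> exists y, i y = x,
      forall x, V x <-> exists z, j z = x,
      (forall y, exists x, p x = y) /\ (forall z, exists x, q x = z) &
      forall x, x = i (p x) + j (q x)].
Proof.
move=> [sU sV UV0 UV].
have [Y [i [iinj iE]]] := embedding_of sU; have [Z [j [jinj jE]]] := embedding_of sV.
have /choice[pq pqE] : forall x, exists yz : Y * Z, x = i yz.1 + j yz.2.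
  move=> x; have [_ /iE[y <-] [_ /jE[z <-] ->]] := UV x.
  by exists (y, z).
have uniq y z y' z' : i y + j z = i y' + j z' -> y = y' /\ z = z'.
  move=> E; have D : i (y - y') = j (z' - z).
    by apply/eqP; rewrite !linearB subr_eq addrAC eq_sym subr_eq addrC -E addrC.
  have : (U `&` V) (i (y - y')).
    by split; [apply/iE; exists (y - y')|rewrite D; apply/jE; exists (z' - z)].
  rewrite UV0 => i0; have j0 : j (z' - z) = 0 by rewrite -D.
  split; apply/subr0_eq; first by apply: iinj; rewrite linear0.
  by apply/eqP; rewrite -oppr_eq0 opprB; apply/eqP; apply: jinj; rewrite linear0.
pose p x := (pq x).1; pose q x := (pq x).2.
have lin : linear p /\ linear q.
  suff h a x y : p (a *: x + y) = a *: p x + p y /\ q (a *: x + y) = a *: q x + q y.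
    by split=> a x y; case: (h a x y).
  by apply: uniq; rewrite -pqE !linearP addrACA -scalerDr /= -!pqE.
have [linp linq] := lin.
pose Lp := GRing.isLinear.Build _ _ _ _ _ linp.
pose P : {linear X -> Y} := HB.pack p Lp.
pose Lq := GRing.isLinear.Build _ _ _ _ _ linq.
pose Q : {linear X -> Z} := HB.pack q Lq.
have Ps y : exists x, P x = y.
  by exists (i y); case: (uniq (p (i y)) (q (i y)) y 0) => //; rewrite -pqE linear0 addr0.
have Qs z : exists x, Q x = z.
  by exists (j z); case: (uniq (p (j z)) (q (j z)) 0 z) => //; rewrite -pqE linear0 add0r.
exists (Modf (fg_image Ps (modf_fg X))), (Modf (fg_image Qs (modf_fg X))), i, j, P, Q.
by split=> //.
Qed.

Theorem local_distributive :
  (forall M : modf A, indecomposable M -> exists! U : set M, maximal_submodule U) ->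
  pretorsion_lattice_distributive A.
Proof.
move=> loc R S T; apply: pretorsion_class_ext => M; split; last first.
  move=> h; split; first by apply: h => N [[]|[]].
  apply: h => N [[_ SN]|[_ TN]]; move=> W hW; apply: hW; by [left|right].
move=> [RM STM] W hW.
have [d [N [dN dlt]]] := fg_rank (modf_fg M).
(* The rank is defined on submodules of a fixed module, so each summand is carried along with an
   embedding into [M]. *)
suff main c (X : modf A) (i : {linear X -> M}) : (d (range i) < c)%N -> injective i ->
    R X -> pretorsion_join S T X -> W X.
  by apply: (main N.+1 M (@idfun M : {linear M -> M})) => //; apply: dN.
elim: c X i => // c IHc X i ltc iinj RX STX.
have [X0|nX0] := pselect (forall x : X, x = 0); first exact: pretorsion0.
have {}nX0 : exists x : X, x <> 0.
  by apply: contra_notP nX0 => h x; apply: contrapT => x0; apply: h; exists x.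
have [indX|nindX] := pselect (indecomposable X).
  by have [SX|TX] := hollow_join (unique_maximal_hollow (loc X indX)) nX0 STX; apply: hW; [left|right].
have [U [V [UV U0 V0]]] : exists U V : set X,
    [/\ direct_decomposition U V, U <> [set 0] & V <> [set 0]].
  apply: contra_notP nindX => h; split=> // U V UV.
  by apply: contrapT => /not_orP[U0 V0]; apply: h; exists U, V.
have [Y [Z [f [g [p [q [[finj ginj] fE gE [ps qs] pqE]]]]]]] := direct_decomposition_modules UV.
have [_ _ UV0 _] := UV.
have sub_range (N' N'' : lmodType A^c) (h : {linear N' -> N''}) : submodule (range h).
  apply/submoduleP; split=> [|a _ _ [u _ <-] [v _ <-]]; first by exists 0; rewrite ?linear0.
  by exists (u |> a + v); rewrite // linearD linear_ract.
have smaller (N1 : modf A) (h : {linear N1 -> X}) (U' V' : set X) : injective h ->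
    (forall x, U' x <-> exists y, h y = x) -> (U' `&` V') = [set 0] -> V' 0 -> V' <> [set 0] ->
    (d (range (i \o h)) < c)%N.
  move=> hinj hE UV'0 V'0 nV'; rewrite -ltnS (leq_trans _ ltc) // ltnS.
  apply: dlt; rewrite ?sub_range //; first exact: (sub_range _ _ (i \o h : {linear N1 -> M})).
    by move=> _ [y _ <-]; exists (h y).
  move=> sub; apply: nV'; apply/seteqP; split=> [v V'v|_ ->//].
  have [|y _ /iinj yv] := sub (i v); first by exists v.
  by rewrite -UV'0; split=> //; apply/hE; exists y.
have U0' : U 0 by case: UV => sU _ _ _; exact: submodule0.
have V0' : V 0 by case: UV => _ sV _ _; exact: submodule0.
have WY : W Y.
  apply: (IHc Y (i \o f)); first exact: (smaller Y f U V).
  - by move=> u v /iinj /finj.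
  - exact: pretorsion_quotient ps RX.
  - exact: pretorsion_quotient ps STX.
have WZ : W Z.
  apply: (IHc Z (i \o g)); first by apply: (smaller Z g V U) => //; rewrite setIC.
  - by move=> u v /iinj /ginj.
  - exact: pretorsion_quotient qs RX.
  - exact: pretorsion_quotient qs STX.
have lin : linear (fun u : Y * Z => f u.1 + g u.2).
  by move=> a u v; rewrite !linearP addrACA -scalerDr.
pose L := GRing.isLinear.Build _ _ _ _ _ lin.
pose F : {linear (Y * Z)%type -> X} := HB.pack (fun u : Y * Z => f u.1 + g u.2) L.
apply: (@pretorsion_quotient _ W (modf_prod Y Z) X F); last exact: pretorsion_sum.
by move=> x; exists (p x, q x); rewrite [RHS]pqE.
Qed.
End Converse.

Theorem proposition4p20 (k : closedFieldType) (A : falgType k) :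
  pretorsion_lattice_distributive A <->
  (forall M : modf A, indecomposable M ->
    exists! U : set M, maximal_submodule U).
Proof. by split; [exact: distributive_local|exact: local_distributive]. Qed.
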